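(* For $A:\mathbb T\to\mathcal U$ and $B:\sqrt{}\,\mathcal U$ (in an arbitrary ambient context), there is an equivalence $$\sqrt{}_{L}\Big(\big(\prod_{s:\mathbb T}A\langle s/L\rangle(s)\big)\to B_{\downarrow}\Big)\;\simeq\;\prod_{t:\mathbb T}\big(A(t)\to B^{1/t}\big),$$ where $B_\downarrow$ under $\mathsf{lock}_L$ denotes $\mathsf{ev}(i.\,B\langle i/L\rangle)$ and the transpension $B^{1/-}:\mathbb T\to\mathcal U$ is defined by $$B^{1/t}:\equiv\sqrt{}_{L}\Big(\big(\prod_{s:\mathbb T} t\langle s/L\rangle = s\big)\to B_{\downarrow}\Big).$$
   Context: Ambient type theory: intensional Martin-Löf type theory with dependent products and sums (with definitional $\beta$ and $\eta$), identity types $=$, function extensionality, and a hierarchy of universes written $\mathcal U$ (levels implicit). $\equiv$ is definitional equality. A vector such as $\vec t/L$ abbreviates a sequence $t_1/L_1,\dots,t_n/L_n$. The theory is extended as follows. (1) There is a closed type $\mathbb T$. (2) If $\Gamma$ is a context, so is $\Gamma,\mathsf{lock}_L$, where $L$ is a fresh lock name. (Binders extend the context on the right.) (3) Variables: if $L_1,\dots,L_n$ are the locks occurring (in order) in $\Gamma'$, and $\Gamma,x:A,\Gamma'\vdash t_m:\mathbb T$ for each $m$, then $\Gamma,x:A,\Gamma'\vdash x\langle \vec t/L\rangle : A[\vec t/\mathsf{key}_L]$. (With no locks this is the usual rule.) (4) Counit (admissible): from $\Gamma,\Gamma''\vdash a:A$ and a term $\Gamma,\Gamma'\vdash t_m:\mathbb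 T$ for each lock $L_m$ of $\Gamma'$, one gets $\Gamma,\Gamma',\Gamma''[\vec t/\mathsf{key}_L]\vdash a[\vec t/\mathsf{key}_L]:A[\vec t/\mathsf{key}_L]$. It commutes with all type and term formers; on variables, for $x$ in $\Gamma$ with $J$ the locks of $\Gamma$ after $x$ and $K$ the locks of $\Gamma''$, $x\langle \vec j/J,\vec k/K\rangle[\vec t/\mathsf{key}_L]:\equiv x\langle \vec j[\vec t/\mathsf{key}_L]/J,\ \vec t\,[\vec k[\vec t/\mathsf{key}_L]/\mathsf{key}_K]/L,\ \vec k[\vec t/\mathsf{key}_L]/K\rangle$; for $x$ in $\Gamma''$ (in particular bound), $x\langle\vec k/K\rangle[\vec t/\mathsf{key}_L]:\equiv x\langle\vec k[\vec t/\mathsf{key}_L]/K\rangle$. (5) Substitution: $(y\langle\vec t/L\rangle)[a/x]:\equiv y\langle\vec t[a/x]/L\rangle$ for $y\neq x$, and $(x\langle\vec t/L\rangle)[a/x]:\equiv a[\vec t[a/x]/\mathsf{key}_L]$. (6) Unit (admissible): from $\Gamma,i:\mathbb T,\mathsf{lock}_L,\Gamma'\vdash a:A$ one gets $\Gamma,\Gamma'[i./\mathsf{lock}_L]\vdash a[i./\mathsf{lock}_L]:A[i./\mathsf{lock}_L]$. It commutes with all formers; on variables, $i\langle t/L,\vec k/K\rangle\mapsto t[i./\mathsf{lock}_L]$; for $x$ in $\Gamma$, $x\langle\vec j/J,t/L,\vec k/K\rangle\mapsto x\langle\vec j[i./\mathsf{lock}_L]/J,\vec k[i./\mathsf{lock}_L]/K\rangle$;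 for $x$ in $\Gamma'$ or bound, $x\langle\vec k/K\rangle\mapsto x\langle\vec k[i./\mathsf{lock}_L]/K\rangle$. (7) Type former $\sqrt{}$ (right adjoint to $\mathsf{lock}$): if $\Gamma,\mathsf{lock}_L\vdash A:\mathcal U$ then $\Gamma\vdash\sqrt{}_L A:\mathcal U$; if $\Gamma,\mathsf{lock}_L\vdash a:A$ then $\Gamma\vdash \mathsf{lock}_L.\,a:\sqrt{}_L A$; if $\Gamma,i:\mathbb T\vdash r:\sqrt{}_L A$ then $\Gamma\vdash\mathsf{ev}(i.\,r):A[i./\mathsf{lock}_L]$ ($i$ bound in $r$). Computation: $\mathsf{ev}(i.\,\mathsf{lock}_L.\,a)\equiv a[i./\mathsf{lock}_L]$; $\eta$: $r\equiv\mathsf{lock}_L.\,\mathsf{ev}(i.\,r[i/\mathsf{key}_L])$. The lock name is omitted when unused (e.g. $\sqrt{}\,\mathcal U$). *)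

(* Defs.v *)
(* A deep embedding of Martin-Löf type theory extended with a tiny type T,
   locked contexts and the right adjoint √ of the lock. *)
From Stdlib Require Import List Arith.
Import ListNotations.

(** * Raw syntax *)

Inductive former : Type :=
  | fT | fU (l : nat)
  | fPi | fLam | fApp
  | fSig | fPair | fFst | fSnd
  | fId | fRefl | fJ | fFunext
  | fSqrt | fLock | fEv.

(* [Var n ts] is x⟨t/L⟩.  The de Bruijn index [n] counts only the variables of
   the context, not its locks; [ts] has one key for each lock to the right of
   x, leftmost lock first, so that lock names are not needed.
   In [Op f args], an argument [(v, l, a)] is a subterm [a] that lives under
   [v] more variables and [l] more locks. *)
Inductive tm : Type :=
  | Var (n : nat) (ts : list tm)
  | Op (f : former) (args : list (nat * nat * tm)).

Definition var (n : nat) : tm := Var n [].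

Definition Tiny : tm := Op fT [].
Definition U (l : nat) : tm := Op (fU l) [].
Definition Pi (A B : tm) : tm := Op fPi [(0, 0, A); (1, 0, B)].
Definition Lam (b : tm) : tm := Op fLam [(1, 0, b)].
Definition App (f a : tm) : tm := Op fApp [(0, 0, f); (0, 0, a)].
Definition Sig (A B : tm) : tm := Op fSig [(0, 0, A); (1, 0, B)].
Definition Pair (a b : tm) : tm := Op fPair [(0, 0, a); (0, 0, b)].
Definition Fst (p : tm) : tm := Op fFst [(0, 0, p)].
Definition Snd (p : tm) : tm := Op fSnd [(0, 0, p)].
Definition Id (A a b : tm) : tm := Op fId [(0, 0, A); (0, 0, a); (0, 0, b)].
Definition Refl (a : tm) : tm := Op fRefl [(0, 0, a)].
Definition J (C d p : tm) : tm := Op fJ [(2, 0, C); (0, 0, d); (0, 0, p)].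
Definition Funext (h : tm) : tm := Op fFunext [(0, 0, h)].
Definition Sqrt (A : tm) : tm := Op fSqrt [(0, 1, A)].
Definition Lock (a : tm) : tm := Op fLock [(0, 1, a)].
Definition Ev (r : tm) : tm := Op fEv [(1, 0, r)].

(* Contexts and telescopes list the most recent entry first: what is usually
   written Γ,Γ' is [G' ++ G]. *)
Inductive entry : Type := Ty (A : tm) | Lk.
Definition ctx : Type := list entry.

Fixpoint nvars (G : ctx) : nat :=
  match G with
  | [] => 0
  | Ty _ :: G => S (nvars G)
  | Lk :: G => nvars G
  end.

Fixpoint nlocks (G : ctx) : nat :=
  match G with
  | [] => 0
  | Ty _ :: G => nlocks G
  | Lk :: G => S (nlocks G)
  end.

(** * Counit, substitution and unit

   [Counit w ts] is the operation [ts/key] that inserts a telescope Γ' with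
   [w] variables, [ts] being one term in Γ,Γ' for each lock of Γ', leftmost
   lock first.  With [ts = []] it is weakening by [w] variables.
   [Subst a] is [a/x], and [Unit] is [i./lock].

   [act o m k a a'] says that [o] sends [a] to [a'], where [m] and [k] are the
   numbers of variables and of locks of the part of the context to the right
   of the place where [o] acts.  The operations are given by their graph
   because the defining equations are not a well-founded recursion: the
   counit calls itself on the keys that it has already rewritten. *)
Inductive operation : Type :=
  | Counit (w : nat) (ts : list tm)
  | Subst (a : tm)
  | Unit.

Inductive act : operation -> nat -> nat -> tm -> tm -> Prop :=
  | act_former o m k f args args' :
      act_args o m k args args' ->
      act o m k (Op f args) (Op f args')
  | act_bound o m k n ks ks' :
      n < m ->
      act_list o m k ks ks' ->
      act o m k (Var n ks) (Var n ks')
  | act_counit w ts m k n js ks js' ks' ts' :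
      m <= n ->
      length ks = k ->
      act_list (Counit w ts) m k js js' ->
      act_list (Counit w ts) m k ks ks' ->
      act_list (Counit m ks') 0 0 ts ts' ->
      act (Counit w ts) m k (Var n (js ++ ks)) (Var (n + w) (js' ++ ts' ++ ks'))
  | act_subst_other a m k n ts ts' :
      m <= n ->
      act_list (Subst a) m k ts ts' ->
      act (Subst a) m k (Var (S n) ts) (Var n ts')
  | act_subst_same a m k ts ts' a' :
      length ts = k ->
      act_list (Subst a) m k ts ts' ->
      act (Counit m ts') 0 0 a a' ->
      act (Subst a) m k (Var m ts) a'
  | act_unit_other m k n js t ks js' ks' :
      m <= n ->
      length ks = k ->
      act_list Unit m k js js' ->
      act_list Unit m k ks ks' ->
      act Unit m k (Var (S n) (js ++ t :: ks)) (Var n (js' ++ ks'))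
  | act_unit_same m k t ks t' :
      length ks = k ->
      act Unit m k t t' ->
      act Unit m k (Var m (t :: ks)) t'
with act_list : operation -> nat -> nat -> list tm -> list tm -> Prop :=
  | act_list_nil o m k : act_list o m k [] []
  | act_list_cons o m k t t' ts ts' :
      act o m k t t' ->
      act_list o m k ts ts' ->
      act_list o m k (t :: ts) (t' :: ts')
with act_args : operation -> nat -> nat ->
    list (nat * nat * tm) -> list (nat * nat * tm) -> Prop :=
  | act_args_nil o m k : act_args o m k [] []
  | act_args_cons o m k v l a a' args args' :
      act o (m + v) (k + l) a a' ->
      act_args o m k args args' ->
      act_args o m k ((v, l, a) :: args) ((v, l, a') :: args').

Inductive act_tele (o : operation) : ctx -> ctx -> Prop :=
  | act_tele_nil : act_tele o [] []
  | act_tele_ty D D' A A' :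
      act_tele o D D' ->
      act o (nvars D) (nlocks D) A A' ->
      act_tele o (Ty A :: D) (Ty A' :: D')
  | act_tele_lock D D' :
      act_tele o D D' ->
      act_tele o (Lk :: D) (Lk :: D').

(* The special case of [Counit w ts] in which the keys [ts] are variables
   (given by their indices [cs]) with no lock of Γ' to their right.  In this
   case the defining equations are structurally recursive. *)
Fixpoint keyed (w : nat) (cs : list nat) (m k : nat) (t : tm) : tm :=
  match t with
  | Var n ts =>
      let ts' := map (keyed w cs m k) ts in
      if n <? m then Var n ts'
      else
        let p := length ts' - k in
        let js := firstn p ts' in
        let ks := skipn p ts' in
        Var (n + w) (js ++ map (fun c => Var (c + m) ks) cs ++ ks)
  | Op f args =>
      Op f (map (fun x => match x with
                          | (v, l, a) => (v, l, keyed w cs (m + v) (k + l) a)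
                          end) args)
  end.

Definition shift (w : nat) (t : tm) : tm := keyed w [] 0 0 t.

(* For [t] in Γ, the term t⟨i/L⟩ in Γ,lock_L,i:T. *)
Definition key (t : tm) : tm := keyed 1 [0] 0 0 t.

Scheme act_mut := Minimality for act Sort Prop
  with act_list_mut := Minimality for act_list Sort Prop
  with act_args_mut := Minimality for act_args Sort Prop.
Combined Scheme act_combined from act_mut, act_list_mut, act_args_mut.

Lemma act_counit_nil :
  (forall o m k t t', act o m k t t' -> o = Counit 0 [] -> t' = t) /\
  (forall o m k ts ts', act_list o m k ts ts' -> o = Counit 0 [] -> ts' = ts) /\
  (forall o m k args args', act_args o m k args args' ->
     o = Counit 0 [] -> args' = args).
Proof.
  apply act_combined; intros; subst; try discriminate; try (f_equal; auto; fail).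
  - match goal with X : Counit _ _ = _ |- _ => injection X as -> -> end.
    match goal with X : act_list _ 0 0 [] _ |- _ => inversion X; subst end.
    rewrite Nat.add_0_r; simpl; repeat (f_equal; auto).
  - repeat (f_equal; auto).
Qed.

Lemma act_list_vars w ts cs ts' :
  act_list (Counit w ts) 0 0 (map var cs) ts' ->
  ts' = map (fun c => Var (c + w) ts) cs.
Proof.
  revert ts'; induction cs as [|c cs IH]; simpl; intros us H;
    inversion H as [|? ? ? ? u ? us' Hu Hus]; subst; auto.
  f_equal; auto.
  inversion Hu as [|? ? ? ? ? ? Hn|? ? ? ? ? js ks js' ks' vs Hm Hk Hjs Hks Hvs| | | |];
    subst.
  - inversion Hn.
  - match goal with X : _ ++ _ = [] |- _ =>
      apply app_eq_nil in X; destruct X; subst end.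
    inversion Hjs; inversion Hks; subst; simpl; rewrite app_nil_r.
    f_equal; eapply act_counit_nil; eauto.
Qed.

Lemma act_keyed w cs :
  (forall o m k t t', act o m k t t' ->
     o = Counit w (map var cs) -> t' = keyed w cs m k t) /\
  (forall o m k ts ts', act_list o m k ts ts' ->
     o = Counit w (map var cs) ->
     length ts' = length ts /\ ts' = map (keyed w cs m k) ts) /\
  (forall o m k args args', act_args o m k args args' ->
     o = Counit w (map var cs) ->
     args' = map (fun x => match x with
                           | (v, l, a) => (v, l, keyed w cs (m + v) (k + l) a)
                           end) args).
Proof.
  apply act_combined; intros; subst; try discriminate; simpl; auto.
  - f_equal; auto.
  - destruct (Nat.ltb_spec n m) as [_|H']; [f_equal; apply H1; auto|].
    exfalso; apply (Nat.lt_irrefl n); eapply Nat.lt_le_trans; eauto.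
  - injection H7 as -> ->.
    destruct (Nat.ltb_spec n m) as [H'|_];
      [exfalso; apply (Nat.lt_irrefl n); eapply Nat.lt_le_trans; eauto|].
    destruct (H2 eq_refl) as [Lj Ej], (H4 eq_refl) as [Lk Ek].
    apply act_list_vars in H5.
    rewrite map_app, <- Ej, <- Ek, length_app, Lk, Nat.add_sub.
    rewrite firstn_app, Nat.sub_diag, firstn_all, skipn_app, Nat.sub_diag, skipn_all.
    simpl; rewrite app_nil_r; subst; auto.
  - destruct (H2 eq_refl) as [L E]; split; f_equal; auto.
  - f_equal; auto. f_equal; auto.
Qed.

(** * Judgements

   Universes are à la Russell and cumulative, and "A is a type" means that A
   is a term of some [U l]. *)

Inductive wf : ctx -> Prop :=
  | wf_nil : wf []
  | wf_ty G A l : has_type G A (U l) -> wf (Ty A :: G)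
  | wf_lock G : wf G -> wf (Lk :: G)

with has_type : ctx -> tm -> tm -> Prop :=
  | ty_var G A D ts A' :
      wf (D ++ Ty A :: G) ->
      length ts = nlocks D ->
      (forall t, In t ts -> has_type (D ++ Ty A :: G) t Tiny) ->
      act (Counit (S (nvars D)) ts) 0 0 A A' ->
      has_type (D ++ Ty A :: G) (Var (nvars D) ts) A'
  | ty_conv G a A B l :
      has_type G a A -> eq_term G A B (U l) -> has_type G a B

  (* Counit, substitution and unit are usually stated as admissible rules. *)
  | ty_counit G G' D D' ts a a' A A' :
      has_type (D ++ G) a A ->
      wf (G' ++ G) ->
      length ts = nlocks G' ->
      (forall t, In t ts -> has_type (G' ++ G) t Tiny) ->
      act_tele (Counit (nvars G') ts) D D' ->
      act (Counit (nvars G') ts) (nvars D) (nlocks D) a a' ->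
      act (Counit (nvars G') ts) (nvars D) (nlocks D) A A' ->
      has_type (D' ++ G' ++ G) a' A'
  | ty_subst G D D' c C a a' A A' :
      has_type G c C ->
      has_type (D ++ Ty C :: G) a A ->
      act_tele (Subst c) D D' ->
      act (Subst c) (nvars D) (nlocks D) a a' ->
      act (Subst c) (nvars D) (nlocks D) A A' ->
      has_type (D' ++ G) a' A'
  | ty_unit G D D' a a' A A' :
      has_type (D ++ Lk :: Ty Tiny :: G) a A ->
      act_tele Unit D D' ->
      act Unit (nvars D) (nlocks D) a a' ->
      act Unit (nvars D) (nlocks D) A A' ->
      has_type (D' ++ G) a' A'

  | ty_U G l : wf G -> has_type G (U l) (U (S l))
  | ty_cumul G A l : has_type G A (U l) -> has_type G A (U (S l))
  | ty_Tiny G : wf G -> has_type G Tiny (U 0)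

  | ty_Pi G A B i j :
      has_type G A (U i) -> has_type (Ty A :: G) B (U j) ->
      has_type G (Pi A B) (U (Nat.max i j))
  | ty_Lam G A B b :
      has_type (Ty A :: G) b B -> has_type G (Lam b) (Pi A B)
  | ty_App G A B B' f a :
      has_type G f (Pi A B) -> has_type G a A ->
      act (Subst a) 0 0 B B' ->
      has_type G (App f a) B'

  | ty_Sig G A B i j :
      has_type G A (U i) -> has_type (Ty A :: G) B (U j) ->
      has_type G (Sig A B) (U (Nat.max i j))
  | ty_Pair G A B B' j a b :
      has_type (Ty A :: G) B (U j) ->
      has_type G a A ->
      act (Subst a) 0 0 B B' ->
      has_type G b B' ->
      has_type G (Pair a b) (Sig A B)
  | ty_Fst G A B p : has_type G p (Sig A B) -> has_type G (Fst p) A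
  | ty_Snd G A B B' p :
      has_type G p (Sig A B) ->
      act (Subst (Fst p)) 0 0 B B' ->
      has_type G (Snd p) B'

  | ty_Id G A a b l :
      has_type G A (U l) -> has_type G a A -> has_type G b A ->
      has_type G (Id A a b) (U l)
  | ty_Refl G A a : has_type G a A -> has_type G (Refl a) (Id A a a)
  (* [C] is a family over y:A, p:(a = y). *)
  | ty_J G A a b C Ca Cb C1 C2 d p l :
      has_type (Ty (Id (shift 1 A) (shift 1 a) (var 0)) :: Ty A :: G) C (U l) ->
      act (Subst a) 1 0 C C1 -> act (Subst (Refl a)) 0 0 C1 Ca ->
      has_type G d Ca ->
      has_type G b A ->
      has_type G p (Id A a b) ->
      act (Subst b) 1 0 C C2 -> act (Subst p) 0 0 C2 Cb ->
      has_type G (J C d p) Cb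
  | ty_Funext G A B f g h :
      has_type G f (Pi A B) -> has_type G g (Pi A B) ->
      has_type G h
        (Pi A (Id B (App (shift 1 f) (var 0)) (App (shift 1 g) (var 0)))) ->
      has_type G (Funext h) (Id (Pi A B) f g)

  | ty_Sqrt G A l : has_type (Lk :: G) A (U l) -> has_type G (Sqrt A) (U l)
  | ty_Lock G A a : has_type (Lk :: G) a A -> has_type G (Lock a) (Sqrt A)
  | ty_Ev G A A' r :
      has_type (Ty Tiny :: G) r (Sqrt A) ->
      act Unit 0 0 A A' ->
      has_type G (Ev r) A'

with eq_term : ctx -> tm -> tm -> tm -> Prop :=
  | deq_refl G a A : has_type G a A -> eq_term G a a A
  | deq_sym G a b A : eq_term G a b A -> eq_term G b a A
  | deq_trans G a b c A :
      eq_term G a b A -> eq_term G b c A -> eq_term G a c A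
  | deq_conv G a b A B l :
      eq_term G a b A -> eq_term G A B (U l) -> eq_term G a b B
  | deq_cumul G A B l : eq_term G A B (U l) -> eq_term G A B (U (S l))

  | deq_counit G G' D D' ts a b a' b' A A' :
      eq_term (D ++ G) a b A ->
      wf (G' ++ G) ->
      length ts = nlocks G' ->
      (forall t, In t ts -> has_type (G' ++ G) t Tiny) ->
      act_tele (Counit (nvars G') ts) D D' ->
      act (Counit (nvars G') ts) (nvars D) (nlocks D) a a' ->
      act (Counit (nvars G') ts) (nvars D) (nlocks D) b b' ->
      act (Counit (nvars G') ts) (nvars D) (nlocks D) A A' ->
      eq_term (D' ++ G' ++ G) a' b' A'
  | deq_subst G D D' c C a b a' b' A A' :
      has_type G c C ->
      eq_term (D ++ Ty C :: G) a b A ->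
      act_tele (Subst c) D D' ->
      act (Subst c) (nvars D) (nlocks D) a a' ->
      act (Subst c) (nvars D) (nlocks D) b b' ->
      act (Subst c) (nvars D) (nlocks D) A A' ->
      eq_term (D' ++ G) a' b' A'
  | deq_unit G D D' a b a' b' A A' :
      eq_term (D ++ Lk :: Ty Tiny :: G) a b A ->
      act_tele Unit D D' ->
      act Unit (nvars D) (nlocks D) a a' ->
      act Unit (nvars D) (nlocks D) b b' ->
      act Unit (nvars D) (nlocks D) A A' ->
      eq_term (D' ++ G) a' b' A'

  | deq_Pi_beta G A B b b' B' a :
      has_type (Ty A :: G) b B -> has_type G a A ->
      act (Subst a) 0 0 b b' -> act (Subst a) 0 0 B B' ->
      eq_term G (App (Lam b) a) b' B'
  | deq_Pi_eta G A B f :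
      has_type G f (Pi A B) ->
      eq_term G f (Lam (App (shift 1 f) (var 0))) (Pi A B)
  | deq_Fst_beta G A B B' j a b :
      has_type (Ty A :: G) B (U j) ->
      has_type G a A -> act (Subst a) 0 0 B B' -> has_type G b B' ->
      eq_term G (Fst (Pair a b)) a A
  | deq_Snd_beta G A B B' j a b :
      has_type (Ty A :: G) B (U j) ->
      has_type G a A -> act (Subst a) 0 0 B B' -> has_type G b B' ->
      eq_term G (Snd (Pair a b)) b B'
  | deq_Sig_eta G A B p :
      has_type G p (Sig A B) ->
      eq_term G p (Pair (Fst p) (Snd p)) (Sig A B)
  | deq_J_beta G A a C Ca C1 d l :
      has_type G a A ->
      has_type (Ty (Id (shift 1 A) (shift 1 a) (var 0)) :: Ty A :: G) C (U l) ->
      act (Subst a) 1 0 C C1 -> act (Subst (Refl a)) 0 0 C1 Ca ->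
      has_type G d Ca ->
      eq_term G (J C d (Refl a)) d Ca
  | deq_Sqrt_beta G A A' a a' :
      has_type (Lk :: Ty Tiny :: G) a A ->
      act Unit 0 0 a a' -> act Unit 0 0 A A' ->
      eq_term G (Ev (Lock a)) a' A'
  | deq_Sqrt_eta G A r :
      has_type G r (Sqrt A) ->
      eq_term G r (Lock (Ev (key r))) (Sqrt A)

  | deq_Var G A D ts us A' :
      wf (D ++ Ty A :: G) ->
      length ts = nlocks D -> length us = nlocks D ->
      (forall t u, In (t, u) (combine ts us) ->
         eq_term (D ++ Ty A :: G) t u Tiny) ->
      act (Counit (S (nvars D)) ts) 0 0 A A' ->
      eq_term (D ++ Ty A :: G) (Var (nvars D) ts) (Var (nvars D) us) A'
  | deq_Pi G A A2 B B2 i j :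
      has_type G A (U i) ->
      eq_term G A A2 (U i) -> eq_term (Ty A :: G) B B2 (U j) ->
      eq_term G (Pi A B) (Pi A2 B2) (U (Nat.max i j))
  | deq_Lam G A B b b2 :
      eq_term (Ty A :: G) b b2 B -> eq_term G (Lam b) (Lam b2) (Pi A B)
  | deq_App G A B B' f f2 a a2 :
      eq_term G f f2 (Pi A B) -> eq_term G a a2 A ->
      act (Subst a) 0 0 B B' ->
      eq_term G (App f a) (App f2 a2) B'
  | deq_Sig G A A2 B B2 i j :
      has_type G A (U i) ->
      eq_term G A A2 (U i) -> eq_term (Ty A :: G) B B2 (U j) ->
      eq_term G (Sig A B) (Sig A2 B2) (U (Nat.max i j))
  | deq_Pair G A B B' j a a2 b b2 :
      has_type (Ty A :: G) B (U j) ->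
      eq_term G a a2 A ->
      act (Subst a) 0 0 B B' ->
      eq_term G b b2 B' ->
      eq_term G (Pair a b) (Pair a2 b2) (Sig A B)
  | deq_Fst G A B p p2 :
      eq_term G p p2 (Sig A B) -> eq_term G (Fst p) (Fst p2) A
  | deq_Snd G A B B' p p2 :
      eq_term G p p2 (Sig A B) ->
      act (Subst (Fst p)) 0 0 B B' ->
      eq_term G (Snd p) (Snd p2) B'
  | deq_Id G A A2 a a2 b b2 l :
      eq_term G A A2 (U l) -> eq_term G a a2 A -> eq_term G b b2 A ->
      eq_term G (Id A a b) (Id A2 a2 b2) (U l)
  | deq_Refl G A a a2 :
      eq_term G a a2 A -> eq_term G (Refl a) (Refl a2) (Id A a a)
  | deq_J G A a b C D Ca Cb C1 C2 d d2 p p2 l :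
      eq_term (Ty (Id (shift 1 A) (shift 1 a) (var 0)) :: Ty A :: G) C D (U l) ->
      act (Subst a) 1 0 C C1 -> act (Subst (Refl a)) 0 0 C1 Ca ->
      eq_term G d d2 Ca ->
      has_type G b A ->
      eq_term G p p2 (Id A a b) ->
      act (Subst b) 1 0 C C2 -> act (Subst p) 0 0 C2 Cb ->
      eq_term G (J C d p) (J D d2 p2) Cb
  | deq_Funext G A B f g h h2 :
      has_type G f (Pi A B) -> has_type G g (Pi A B) ->
      eq_term G h h2
        (Pi A (Id B (App (shift 1 f) (var 0)) (App (shift 1 g) (var 0)))) ->
      eq_term G (Funext h) (Funext h2) (Id (Pi A B) f g)
  | deq_Sqrt G A A2 l :
      eq_term (Lk :: G) A A2 (U l) -> eq_term G (Sqrt A) (Sqrt A2) (U l)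
  | deq_Lock G A a a2 :
      eq_term (Lk :: G) a a2 A -> eq_term G (Lock a) (Lock a2) (Sqrt A)
  | deq_Ev G A A' r r2 :
      eq_term (Ty Tiny :: G) r r2 (Sqrt A) ->
      act Unit 0 0 A A' ->
      eq_term G (Ev r) (Ev r2) A'.

(** * Equivalences and the transpension *)

Definition Arrow (A B : tm) : tm := Pi A (shift 1 B).
Definition Prod (A B : tm) : tm := Sig A (shift 1 B).

(* [f] has a left inverse and a right inverse. *)
Definition BiInv (X Y f : tm) : tm :=
  Prod
    (Sig (Arrow Y X)
       (Pi (shift 1 X)
          (Id (shift 2 X) (App (var 1) (App (shift 2 f) (var 0))) (var 0))))
    (Sig (Arrow Y X)
       (Pi (shift 1 Y)
          (Id (shift 2 Y) (App (shift 2 f) (App (var 1) (var 0))) (var 0)))).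

Definition Equiv (X Y : tm) : tm :=
  Sig (Arrow X Y) (BiInv (shift 1 X) (shift 1 Y) (var 0)).

(* For [B] in Γ, the type B↓ in Γ,lock. *)
Definition Down (B : tm) : tm := Ev (key B).

(* For [B] and [t] in Γ, the type B^{1/t} in Γ. *)
Definition Transpension (B t : tm) : tm :=
  Sqrt (Arrow (Pi Tiny (Id Tiny (key t) (var 0))) (Down B)).

(* Main.v *)
(* In named syntax the two maps are
     f  |->  λ t a. lock_M. λ p. ev(i. f⟨i/M⟩) (λ s. transport (p s) a⟨s/M⟩),
     g  |->  lock_L. λ h. ev(i. g⟨i/L⟩ i (h i)) (λ s. refl).
   One composite is the identity by computation and η.  For the other one, only a
   path under a lock is available at first, and an identification under a lock does
   not in general give one of elements of √.  Instead, let
     glue k = lock_M. λ p. ev(i. k⟨i/M⟩ i (p i)) (λ s. refl) : B^{1/t}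
   for k : Π t', t = t' -> B^{1/t'}.  By function extensionality and J, glue k = glue k'
   as soon as k t refl = k' t refl.  Every operation μ : x = y -> y = z -> x = z and
   m : B^{1/t} give
     k_μ = λ t' q. lock_M. λ p. ev(i. m⟨i/M⟩) (λ s. μ (q⟨s/M⟩) (p s)),
   with k_μ t refl = lock_M. λ p. ev(i. m⟨i/M⟩) (λ s. μ refl (p s)) and
   glue k_μ = lock_M. λ p. ev(i. m⟨i/M⟩) (λ s. μ (p s) refl).  Varying μ turns
   identifications of paths in T into identifications in B^{1/t}.

   The equivalence is built for variables A and B on top of an arbitrary context,
   where a verified type checker computes its type, and then A and B are
   substituted. *)
From Stdlib Require Import List Arith Lia Bool.
Require Import Defs.
Import ListNotations.

(** * Running the operations with fuel *)

Notation "'let?' p := e 'in' k" := (match e with Some p => k | None => None end)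
  (at level 200, p pattern, e at level 200, k at level 200, only parsing).

Fixpoint traverse {A B} (f : A -> option B) (l : list A) : option (list B) :=
  match l with
  | [] => Some []
  | a :: l => let? b := f a in let? bs := traverse f l in Some (b :: bs)
  end.

(** Fuel is needed because the counit is called again on keys that it has itself rewritten. [None]
    stands for exhausted fuel or a key list of unfit length. The last [k] keys belong to the locks
    to the right of the place of action; for [Unit], the key at position [length ts - S k], just
    before them, is that of the removed lock. *)
Fixpoint actf (n : nat) (o : operation) (m k : nat) (t : tm) {struct n} : option tm :=
  match n with
  | 0 => None
  | S n =>
      match t with
      | Op f args =>
          let? args' := traverse (fun x => match x with (v, l, a) =>
                     let? a' := actf n o (m + v) (k + l) a in Some (v, l, a') end) args in
          Some (Op f args')
      | Var x ts =>
          let? ts' := traverse (actf n o m k) ts in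
          if x <? m then Some (Var x ts')
          else
            match o with
            | Counit w us =>
                if length ts <? k then None
                else
                  let p := length ts - k in
                  let? us' := traverse (actf n (Counit m (skipn p ts')) 0 0) us in
                  Some (Var (x + w) (firstn p ts' ++ us' ++ skipn p ts'))
            | Subst a =>
                if x =? m then
                  if length ts =? k then actf n (Counit m ts') 0 0 a else None
                else Some (Var (pred x) ts')
            | Unit =>
                if length ts <=? k then None
                else
                  let p := length ts - S k in
                  if x =? m then
                    match p, ts' with
                    | 0, t' :: _ => Some t'
                    | _, _ => None
                    end
                  else Some (Var (pred x) (firstn p ts' ++ skipn (S p) ts'))
            end
      end
  end.

Lemma traverse_length {A B} (f : A -> option B) l l' :
  traverse f l = Some l' -> length l' = length l.
Proof.
  revert l'; induction l as [|a l IH]; simpl; intros l' H.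
  - injection H as <-; auto.
  - destruct (f a), (traverse f l); try discriminate; injection H as <-; simpl; auto.
Qed.

Lemma traverse_act o m k f ts ts' :
  (forall t t', f t = Some t' -> act o m k t t') ->
  traverse f ts = Some ts' -> act_list o m k ts ts'.
Proof.
  intros Hf; revert ts'; induction ts as [|t ts IH]; simpl; intros ts' H.
  - injection H as <-; constructor.
  - destruct (f t) eqn:E, (traverse f ts); try discriminate; injection H as <-.
    constructor; auto.
Qed.

Lemma act_list_firstn o m k p ts ts' :
  act_list o m k ts ts' -> act_list o m k (firstn p ts) (firstn p ts').
Proof.
  intros H; revert p; induction H; intros [|p]; simpl; constructor; auto.
Qed.

Lemma act_list_skipn o m k p ts ts' :
  act_list o m k ts ts' -> act_list o m k (skipn p ts) (skipn p ts').
Proof.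
  intros H; revert p; induction H; intros [|p]; simpl; try constructor; auto.
Qed.

Lemma actf_sound n o m k t t' : actf n o m k t = Some t' -> act o m k t t'.
Proof.
  revert o m k t t'; induction n as [|n IH]; intros o m k t t' H; [discriminate|].
  destruct t as [x ts|f args]; cbn [actf] in H.
  - destruct (traverse (actf n o m k) ts) as [ts'|] eqn:E; [|discriminate].
    assert (L := traverse_length _ _ _ E).
    apply traverse_act with (o := o) (m := m) (k := k) in E; [|auto].
    destruct (Nat.ltb_spec x m) as [Hx|Hx].
    { injection H as <-; constructor; auto. }
    destruct o as [w us|a|].
    + destruct (Nat.ltb_spec (length ts) k); [discriminate|].
      cbv zeta in H; set (p := length ts - k) in *.
      destruct (traverse _ us) as [us'|] eqn:Eu in H; [|discriminate].
      injection H as <-.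
      rewrite <- (firstn_skipn p ts); constructor; auto.
      * rewrite length_skipn; subst p; lia.
      * apply act_list_firstn; auto.
      * apply act_list_skipn; auto.
      * eapply traverse_act; eauto.
    + destruct (Nat.eqb_spec x m) as [->|].
      * destruct (Nat.eqb_spec (length ts) k); [|discriminate].
        eapply act_subst_same; eauto.
      * injection H as <-; destruct x as [|x]; [lia|]; simpl.
        constructor; auto; lia.
    + destruct (Nat.leb_spec (length ts) k); [discriminate|].
      cbv zeta in H; remember (length ts - S k) as p eqn:Ep.
      (* More than [k] keys are present, so the removed lock has a key: it is the result if the
         variable is the [i] of the unit, and is dropped otherwise. *)
      assert (exists t ks, skipn p ts = t :: ks) as (t & ks & Es).
      { destruct (skipn p ts) eqn:Es; eauto.
        apply (f_equal (@length _)) in Es; rewrite length_skipn in Es; simpl in Es; lia. }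
      assert (El := f_equal (@length _) Es); rewrite length_skipn in El; simpl in El.
      assert (Es' : skipn (S p) ts = ks).
      { replace (S p) with (1 + p) by lia; rewrite <- skipn_skipn, Es; auto. }
      destruct (Nat.eqb_spec x m) as [->|].
      * destruct p as [|p]; [|discriminate].
        simpl in Es; subst ts.
        inversion E; subst; injection H as <-.
        apply act_unit_same; auto; cbn [length] in *; lia.
      * injection H as <-; destruct x as [|x]; [lia|]; simpl.
        rewrite <- (firstn_skipn p ts), Es; constructor; auto; try lia.
        -- apply act_list_firstn; auto.
        -- rewrite <- Es'; exact (act_list_skipn _ _ _ (S p) _ _ E).
  - destruct (traverse _ args) as [args'|] eqn:E; [|discriminate].
    injection H as <-; constructor.
    revert args' E; induction args as [|[[v l] a] args IHargs]; simpl; intros args' E.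
    + injection E as <-; constructor.
    + destruct (actf n o (m + v) (k + l) a) eqn:Ea; [|discriminate].
      destruct (traverse _ args); [|discriminate].
      injection E as <-; constructor; auto.
Qed.

(** * Induction on terms and syntactic equality *)

(** The generated principle has no induction hypotheses for subterms nested in lists. *)
Lemma tm_forall_ind (P : tm -> Prop) :
  (forall n ts, Forall P ts -> P (Var n ts)) ->
  (forall f args, Forall (fun x => P (snd x)) args -> P (Op f args)) ->
  forall t, P t.
Proof.
  intros HV HO; fix IH 1; intros [n ts|f args].
  - apply HV; induction ts; constructor; auto.
  - apply HO; induction args as [|[vl a] args]; constructor; simpl; auto.
Qed.

Definition former_eqb (f g : former) : bool :=
  match f, g with
  | fT, fT | fPi, fPi | fLam, fLam | fApp, fApp | fSig, fSig | fPair, fPair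
  | fFst, fFst | fSnd, fSnd | fId, fId | fRefl, fRefl | fJ, fJ
  | fFunext, fFunext | fSqrt, fSqrt | fLock, fLock | fEv, fEv => true
  | fU l, fU l' => l =? l'
  | _, _ => false
  end.

(** The comparison [e] stays outside the [fix], so that [tm_eqb] may pass itself for it and remain
    structurally recursive. *)
Definition list_eqb {A} (e : A -> A -> bool) : list A -> list A -> bool :=
  fix list_eqb l l' :=
    match l, l' with
    | [], [] => true
    | a :: l, a' :: l' => e a a' && list_eqb l l'
    | _, _ => false
    end.

Fixpoint tm_eqb (t u : tm) : bool :=
  match t, u with
  | Var n ts, Var n' ts' => (n =? n') && list_eqb tm_eqb ts ts'
  | Op f args, Op f' args' =>
      former_eqb f f' &&
      list_eqb (fun x y => match x, y with
                           | (v, l, a), (v', l', a') =>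
                               (v =? v') && (l =? l') && tm_eqb a a'
                           end) args args'
  | _, _ => false
  end.

Lemma tm_eqb_eq t u : tm_eqb t u = true -> t = u.
Proof.
  revert u; induction t as [n ts IH|f args IH] using tm_forall_ind; intros [n' ts'|f' args'];
    try discriminate; simpl; rewrite andb_true_iff; intros [H1 H2]; f_equal.
  - apply Nat.eqb_eq; auto.
  - revert ts' H2; induction IH as [|t ts Ht Hts IHts]; intros [|t' ts']; simpl;
      try discriminate; auto.
    rewrite andb_true_iff; intros [E Es]; f_equal; auto.
  - destruct f, f'; try discriminate; auto.
    apply Nat.eqb_eq in H1; subst; auto.
  - revert args' H2; induction IH as [|[[v l] a] args Ha Hargs IHargs];
      intros [|[[v' l'] a'] args']; simpl; try discriminate; auto.
    rewrite !andb_true_iff, !Nat.eqb_eq; intros [[[-> ->] E] Es].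
    apply Ha in E; simpl in E; subst; f_equal; auto.
Qed.

(** * Annotated terms *)

(* The checker below works on raw terms in which three formers carry extra
   leading arguments, which make types inferable: [lam A b], [pair A B a b] and
   [funext f g h].  [erase] removes them. *)
Definition lam (A b : tm) : tm := Op fLam [(0, 0, A); (1, 0, b)].
Definition pair (A B a b : tm) : tm :=
  Op fPair [(0, 0, A); (1, 0, B); (0, 0, a); (0, 0, b)].
Definition funext (f g h : tm) : tm := Op fFunext [(0, 0, f); (0, 0, g); (0, 0, h)].

Definition annotations (f : former) : nat :=
  match f with fLam => 1 | fPair | fFunext => 2 | _ => 0 end.

Fixpoint erase (t : tm) : tm :=
  match t with
  | Var n ts => Var n (map erase ts)
  | Op f args =>
      Op f (skipn (annotations f)
              (map (fun x => match x with (v, l, a) => (v, l, erase a) end) args))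
  end.

Definition erase_entry (e : entry) : entry :=
  match e with Ty A => Ty (erase A) | Lk => Lk end.
Definition erase_ctx : ctx -> ctx := map erase_entry.

Definition erase_op (o : operation) : operation :=
  match o with
  | Counit w ts => Counit w (map erase ts)
  | Subst a => Subst (erase a)
  | Unit => Unit
  end.

Lemma act_args_skipn o m k p args args' :
  act_args o m k args args' -> act_args o m k (skipn p args) (skipn p args').
Proof.
  intros H; revert p; induction H; intros [|p]; simpl; try constructor; auto.
Qed.

(** The operations treat annotations like any other argument, so dropping leading arguments commutes
    with them. *)
Lemma act_erase_combined :
  (forall o m k t t', act o m k t t' -> act (erase_op o) m k (erase t) (erase t')) /\
  (forall o m k ts ts', act_list o m k ts ts' ->
     act_list (erase_op o) m k (map erase ts) (map erase ts')) /\
  (forall o m k args args', act_args o m k args args' ->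
     act_args (erase_op o) m k
       (map (fun x => match x with (v, l, a) => (v, l, erase a) end) args)
       (map (fun x => match x with (v, l, a) => (v, l, erase a) end) args')).
Proof.
  apply act_combined; intros; simpl in *; subst; rewrite ?map_app;
    try (econstructor; rewrite ?length_map; eauto; fail).
  - constructor; apply act_args_skipn; auto.
  - simpl; constructor; rewrite ?length_map; auto.
Qed.

Lemma act_erase o m k t t' : act o m k t t' -> act (erase_op o) m k (erase t) (erase t').
Proof. apply act_erase_combined. Qed.

Lemma erase_keyed w cs m k t : erase (keyed w cs m k t) = keyed w cs m k (erase t).
Proof.
  revert m k; induction t as [n ts IH|f args IH] using tm_forall_ind; intros m k; simpl.
  - assert (E : map erase (map (keyed w cs m k) ts) = map (keyed w cs m k) (map erase ts)).
    { rewrite !map_map; apply map_ext_Forall; eapply Forall_impl; [|eauto]; auto. }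
    destruct (n <? m); simpl; rewrite ?E; auto.
    rewrite !map_app, map_map; f_equal; rewrite <- E, !length_map, !firstn_map, !skipn_map.
    repeat f_equal.
  - f_equal; rewrite <- skipn_map; f_equal; rewrite !map_map.
    apply map_ext_Forall; eapply Forall_impl; [|eauto].
    intros [[v l] a] Ha; simpl in *; rewrite Ha; auto.
Qed.

Lemma nvars_erase D : nvars (erase_ctx D) = nvars D.
Proof. induction D as [|[A|] D IH]; simpl; auto. Qed.

Lemma nlocks_erase D : nlocks (erase_ctx D) = nlocks D.
Proof. induction D as [|[A|] D IH]; simpl; auto. Qed.

(** * One-step views of annotated terms *)

Inductive view : Type :=
  | VVar (x : nat) (ts : list tm)
  | VTiny | VU (l : nat)
  | VPi (A B : tm) | VLam (A b : tm) | VApp (f a : tm)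
  | VSig (A B : tm) | VPair (A B a b : tm)
  | VId (A a b : tm) | VRefl (a : tm) | VJ (C d p : tm) | VFunext (f g h : tm)
  | VSqrt (A : tm) | VLock (a : tm) | VEv (r : tm)
  | VOther (t : tm).

Definition view_of (t : tm) : view :=
  match t with
  | Var x ts => VVar x ts
  | Op fT [] => VTiny
  | Op (fU l) [] => VU l
  | Op fPi [(0, 0, A); (1, 0, B)] => VPi A B
  | Op fLam [(0, 0, A); (1, 0, b)] => VLam A b
  | Op fApp [(0, 0, f); (0, 0, a)] => VApp f a
  | Op fSig [(0, 0, A); (1, 0, B)] => VSig A B
  | Op fPair [(0, 0, A); (1, 0, B); (0, 0, a); (0, 0, b)] => VPair A B a b
  | Op fId [(0, 0, A); (0, 0, a); (0, 0, b)] => VId A a b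
  | Op fRefl [(0, 0, a)] => VRefl a
  | Op fJ [(2, 0, C); (0, 0, d); (0, 0, p)] => VJ C d p
  | Op fFunext [(0, 0, f); (0, 0, g); (0, 0, h)] => VFunext f g h
  | Op fSqrt [(0, 1, A)] => VSqrt A
  | Op fLock [(0, 1, a)] => VLock a
  | Op fEv [(1, 0, r)] => VEv r
  | t => VOther t
  end.

Definition unview (v : view) : tm :=
  match v with
  | VVar x ts => Var x ts
  | VTiny => Tiny | VU l => U l
  | VPi A B => Pi A B | VLam A b => lam A b | VApp f a => App f a
  | VSig A B => Sig A B | VPair A B a b => pair A B a b
  | VId A a b => Id A a b | VRefl a => Refl a | VJ C d p => J C d p
  | VFunext f g h => funext f g h
  | VSqrt A => Sqrt A | VLock a => Lock a | VEv r => Ev r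
  | VOther t => t
  end.

Lemma unview_view_of t : unview (view_of t) = t.
Proof.
  destruct t as [x ts|f args]; [reflexivity|].
  destruct f; simpl; try reflexivity;
    repeat (match goal with |- context [match ?x with _ => _ end] => destruct x end;
            try reflexivity).
Qed.

Lemma view_of_eq t v : view_of t = v -> t = unview v.
Proof. intros <-; symmetry; apply unview_view_of. Qed.

(** * A partial type checker *)

(** The type is returned as it stands in its own part of the context, with the number of locks
    passed on the way; [infer] then moves it by the counit at the keys of the variable. *)
Fixpoint lookup (D : ctx) (x : nat) : option (tm * nat) :=
  match D with
  | [] => None
  | Ty A :: D => match x with 0 => Some (A, 0) | S x => lookup D x end
  | Lk :: D => let? (A, l) := lookup D x in Some (A, S l)
  end.

Definition level (T : option tm) : option nat :=
  let? T := T in match view_of T with VU l => Some l | _ => None end.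

(* Meant to invert [keyed w cs] for [length cs = c]; no proof is needed because [norm]
   checks the result by applying [keyed] again. *)
Fixpoint unkeyed (w c m k : nat) (t : tm) : tm :=
  match t with
  | Var n ts =>
      let ts' := map (unkeyed w c m k) ts in
      if n <? m then Var n ts'
      else
        let p := length ts' - k in
        Var (n - w) (firstn (p - c) ts' ++ skipn p ts')
  | Op f args =>
      Op f (map (fun x => match x with
                          | (v, l, a) => (v, l, unkeyed w c (m + v) (k + l) a)
                          end) args)
  end.

(** The judgements concern erased terms, so differing annotations must not make a comparison
    fail. *)
Definition eq_erased (t u : tm) : bool := tm_eqb (erase t) (erase u).

(** Fuel for [actf] only; the recursion depth of the checker is a separate argument. *)
Definition fuel : nat := 1000.

Definition Jctx (A a : tm) (D : ctx) : ctx :=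
  Ty (Id (shift 1 A) (shift 1 a) (var 0)) :: Ty A :: D.

Definition Jtype (C b p : tm) : option tm :=
  let? C1 := actf fuel (Subst b) 1 0 C in actf fuel (Subst p) 0 0 C1.

Definition pointwise (A B f g : tm) : tm :=
  Pi A (Id B (App (shift 1 f) (var 0)) (App (shift 1 g) (var 0))).

(* Only soundness is claimed: e.g. [norm] fails on J at a reflexivity path whose
   endpoint is not syntactically the left endpoint of its type, and it does not
   reduce projections. *)
Fixpoint infer (n : nat) (D : ctx) (t : tm) {struct n} : option tm :=
  match n with
  | 0 => None
  | S n =>
      match view_of t with
      | VVar x ts =>
          let? (A, l) := lookup D x in
          if (length ts =? l) && forallb (fun t => check n D t Tiny) ts
          then actf fuel (Counit (S x) ts) 0 0 A else None
      | VTiny => Some (U 0)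
      | VU l => Some (U (S l))
      | VPi A B | VSig A B =>
          let? i := level (infer n D A) in
          let? j := level (infer n (Ty A :: D) B) in
          Some (U (Nat.max i j))
      | VLam A b =>
          let? _ := level (infer n D A) in
          let? B := infer n (Ty A :: D) b in
          Some (Pi A B)
      | VApp f a =>
          let? F := infer n D f in
          match view_of F with
          | VPi A B => if check n D a A then actf fuel (Subst a) 0 0 B else None
          | _ => None
          end
      | VPair A B a b =>
          let? _ := level (infer n D A) in
          let? _ := level (infer n (Ty A :: D) B) in
          let? B' := actf fuel (Subst a) 0 0 B in
          if check n D a A && check n D b B' then Some (Sig A B) else None
      | VId A a b =>
          let? l := level (infer n D A) in
          if check n D a A && check n D b A then Some (U l) else None
      | VRefl a => let? A := infer n D a in Some (Id A a a)
      | VJ C d p =>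
          let? P := infer n D p in
          match view_of P with
          | VId A a b =>
              let? _ := level (infer n D A) in
              let? _ := level (infer n (Ty A :: D) (Id (shift 1 A) (shift 1 a) (var 0))) in
              let? _ := level (infer n (Jctx A a D) C) in
              let? Ca := Jtype C a (Refl a) in
              let? Cb := Jtype C b p in
              if check n D d Ca && check n D b A then Some Cb else None
          | _ => None
          end
      | VFunext f g h =>
          let? F := infer n D f in
          match view_of F with
          | VPi A B =>
              if check n D g F && check n D h (pointwise A B f g)
              then Some (Id F f g) else None
          | _ => None
          end
      | VSqrt A => let? l := level (infer n (Lk :: D) A) in Some (U l)
      | VLock a => let? A := infer n (Lk :: D) a in Some (Sqrt A)
      | VEv r =>
          let? R := infer n (Ty Tiny :: D) r in
          match view_of R with VSqrt A => actf fuel Unit 0 0 A | _ => None end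
      | VOther _ => None
      end
  end

with check (n : nat) (D : ctx) (t A : tm) {struct n} : bool :=
  match n with
  | 0 => false
  | S n => match infer n D t with Some T => conv n D T A | None => false end
  end

with conv (n : nat) (D : ctx) (A B : tm) {struct n} : bool :=
  match n with
  | 0 => false
  | S n =>
      if eq_erased A B then true
      else
        match norm n D A, norm n D B with
        | Some (A', K), Some (B', L) =>
            if level (Some K) then if level (Some L) then eq_erased A' B' else false
            else false
        | _, _ => false
        end
  end

with norm (n : nat) (D : ctx) (t : tm) {struct n} : option (tm * tm) :=
  match n with
  | 0 => None
  | S n =>
      match view_of t with
      | VPi A B =>
          let? (A', K) := norm n D A in
          let? i := level (Some K) in
          let? (B', L) := norm n (Ty A :: D) B in
          let? j := level (Some L) in
          Some (Pi A' B', U (Nat.max i j))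
      | VLam A b =>
          let? _ := level (infer n D A) in
          let? (b', B) := norm n (Ty A :: D) b in
          match view_of b' with
          | VApp f x =>
              let f' := unkeyed 1 0 0 0 f in
              if eq_erased f (shift 1 f') && eq_erased x (var 0) then
                let? F := infer n D f' in
                if eq_erased F (Pi A B) then Some (f', Pi A B)
                else Some (lam A b', Pi A B)
              else Some (lam A b', Pi A B)
          | _ => Some (lam A b', Pi A B)
          end
      | VApp f a =>
          let? (f', F) := norm n D f in
          match view_of F with
          | VPi A B =>
              let? a' := norm_at n D a A in
              let? T := actf fuel (Subst a) 0 0 B in
              match view_of f' with
              | VLam A1 b =>
                  let? _ := level (infer n D A1) in
                  let? B1 := infer n (Ty A1 :: D) b in
                  let? b' := actf fuel (Subst a') 0 0 b in
                  let? T1 := actf fuel (Subst a') 0 0 B1 in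
                  if check n D a' A1 && conv n D T1 T then
                    let? u := norm_at n D b' T in Some (u, T)
                  else None
              | _ => Some (App f' a', T)
              end
          | _ => None
          end
      | VId A a b =>
          let? (A', K) := norm n D A in
          let? l := level (Some K) in
          let? a' := norm_at n D a A in
          let? b' := norm_at n D b A in
          Some (Id A' a' b', U l)
      | VRefl a => let? (a', A) := norm n D a in Some (Refl a', Id A a a)
      | VJ C d p =>
          let? (p', P) := norm n D p in
          match view_of P with
          | VId A a b =>
              let? _ := level (infer n D A) in
              let? _ := level (infer n (Ty A :: D) (Id (shift 1 A) (shift 1 a) (var 0))) in
              let? (C', K) := norm n (Jctx A a D) C in
              let? _ := level (Some K) in
              let? Ca := Jtype C a (Refl a) in
              let? Cb := Jtype C b p in
              let? d' := norm_at n D d Ca in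
              if check n D a A && check n D b A then
                match view_of p' with
                | VRefl a' =>
                    if eq_erased a a' && conv n D Ca Cb then Some (d', Cb) else None
                | _ => Some (J C' d' p', Cb)
                end
              else None
          | _ => None
          end
      | VSqrt A =>
          let? (A', K) := norm n (Lk :: D) A in
          let? l := level (Some K) in Some (Sqrt A', U l)
      | VLock a =>
          let? (a', A) := norm n (Lk :: D) a in
          match view_of a' with
          | VEv r =>
              let r' := unkeyed 1 1 0 0 r in
              if eq_erased r (key r') then
                let? R := infer n D r' in
                if eq_erased R (Sqrt A) then Some (r', Sqrt A)
                else Some (Lock a', Sqrt A)
              else Some (Lock a', Sqrt A)
          | _ => Some (Lock a', Sqrt A)
          end
      | VEv r =>
          let? (r', R) := norm n (Ty Tiny :: D) r in
          match view_of R with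
          | VSqrt A =>
              let? T := actf fuel Unit 0 0 A in
              match view_of r' with
              | VLock a =>
                  let? A1 := infer n (Lk :: Ty Tiny :: D) a in
                  let? a' := actf fuel Unit 0 0 a in
                  let? T1 := actf fuel Unit 0 0 A1 in
                  if conv n D T1 T then
                    let? u := norm_at n D a' T in Some (u, T)
                  else None
              | _ => Some (Ev r', T)
              end
          | _ => None
          end
      | _ => let? T := infer n D t in Some (t, T)
      end
  end

with norm_at (n : nat) (D : ctx) (t A : tm) {struct n} : option tm :=
  match n with
  | 0 => None
  | S n => let? (t', T) := norm n D t in if conv n D T A then Some t' else None
  end.

(** * The equivalence *)

(** No former with annotations occurs here or in [RightType], so for variables [A] and [B] erasure
    leaves both types unchanged. *)
Definition LeftType (A B : tm) : tm :=
  Sqrt (Arrow (Pi Tiny (App (key A) (var 0))) (Down B)).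

Definition RightType (A B : tm) : tm :=
  Pi Tiny (Arrow (App (shift 1 A) (var 0)) (Transpension (shift 1 B) (var 0))).

(* For [t] in Γ, the type Π s:T, t⟨s/L⟩ = s in Γ,lock_L. *)
Definition EqualsKey (t : tm) : tm := Pi Tiny (Id Tiny (key t) (var 0)).

(** The transport is J with motive A⟨s/M⟩(y). In [keyed 7 [2]] the seven variables are f, t, a, p, s
    and the two of the motive, and index 2 is s, the key for the lock between a and p. *)
Definition forward (A B : tm) : tm :=
  lam (LeftType A B)
    (lam Tiny
       (lam (App (shift 2 A) (var 0))
          (Lock
             (lam (EqualsKey (var 1))
                (App (Ev (Var 4 [var 0]))
                   (lam Tiny
                      (J (App (keyed 7 [2] 0 0 A) (var 1))
                         (Var 2 [var 0])
                         (App (var 1) (var 0))))))))).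

(* Here [k] lives in Γ and [P] in Γ,lock. *)
Definition glue (P k : tm) : tm :=
  Lock
    (lam P
       (App (Ev (App (App (keyed 2 [0] 0 0 k) (var 0)) (App (var 1) (var 0))))
          (lam Tiny (Refl (var 0))))).

Definition backward (A B : tm) : tm :=
  lam (RightType A B) (glue (Pi Tiny (App (keyed 2 [0] 0 0 A) (var 0))) (var 0)).

Definition Based (B t : tm) : tm :=
  Pi Tiny (Arrow (Id Tiny (shift 1 t) (var 0)) (Transpension (shift 1 B) (var 0))).

(** The outer J runs along k = k', which [funext] builds from a path at every t' and q; the inner J
    contracts q to reflexivity, where the assumed path w applies. *)
Definition glue_ext (B : tm) : tm :=
  lam Tiny
    (lam (Based (shift 1 B) (var 0))
       (lam (Based (shift 2 B) (var 1))
          (lam (Id (Transpension (shift 3 B) (var 2))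
                  (App (App (var 1) (var 2)) (Refl (var 2)))
                  (App (App (var 0) (var 2)) (Refl (var 2))))
             (J (Id (Transpension (shift 6 B) (var 5))
                    (glue (EqualsKey (var 5)) (var 4))
                    (glue (EqualsKey (var 5)) (var 1)))
                (Refl (glue (EqualsKey (var 3)) (var 2)))
                (funext (var 2) (var 1)
                   (lam Tiny
                      (funext (App (var 3) (var 0)) (App (var 2) (var 0))
                         (lam (Id Tiny (var 4) (var 0))
                            (J (Id (Transpension (shift 8 B) (var 1))
                                  (App (App (var 6) (var 1)) (var 0))
                                  (App (App (var 5) (var 1)) (var 0)))
                               (var 2)
                               (var 0)))))))))).

(** Concatenation by J on the right path: [concat_r x q (Refl _)] computes to [q]. In contrast,
    [concat_l] eliminates the left path and computes to [p] when [q] is reflexivity. Which side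
    computes is what [counit_path] exploits. *)
Definition concat_r (x q p : tm) : tm :=
  J (Id Tiny (shift 2 x) (var 1)) q p.

Definition concat_l (x z q p : tm) : tm :=
  App
    (J (Arrow (Id Tiny (var 1) (shift 2 z)) (Id Tiny (shift 2 x) (shift 2 z)))
       (lam (Id Tiny x z) (var 0))
       q)
    p.

(* The term k_μ; [mu] also receives the three endpoints. *)
Definition act_by (mu : tm -> tm -> tm -> tm -> tm -> tm) (t m : tm) : tm :=
  lam Tiny
    (lam (Id Tiny (shift 1 t) (var 0))
       (Lock
          (lam (EqualsKey (var 1))
             (App (Ev (keyed 4 [0] 0 0 m))
                (lam Tiny
                   (mu (keyed 4 [0] 0 0 t) (Var 3 [var 0]) (var 0)
                       (Var 2 [var 0]) (App (var 1) (var 0)))))))).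

(* Let c = (concat_r refl) and c' = (λ h. concat_l h refl).  Both [k1] and [k2] act at
   reflexivity by c; they glue to m itself and to the image of m under c ∘ c'.  Hence m
   is its own image under c ∘ c', which is the value of [k3] at reflexivity, while [k]
   has the value m there.  Finally [k3] glues to m, and [k] to the composite of
   [forward] and [backward]. *)
Definition counit_path (A B : tm) : tm :=
  let t := var 1 in
  let m := App (App (var 2) (var 1)) (var 0) in
  let ext k k' w := App (App (App (App (glue_ext (shift 3 B)) t) k) k') w in
  let k1 := act_by (fun x y z q p => concat_r x q p) t m in
  let k2 := act_by (fun x y z q p => concat_r x (Refl x) (concat_l x z q p)) t m in
  let k3 := act_by (fun x y z q p => concat_r x q (concat_l y z p (Refl z))) t m in
  let k :=
    lam Tiny
      (lam (Id Tiny (var 2) (var 0))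
         (App (App (var 4) (var 1)) (J (App (shift 7 A) (var 1)) (var 2) (var 0)))) in
  ext k k3 (ext k1 k2 (Refl (App (App k1 t) (Refl t)))).

(** The homotopy from [forward] after [backward] to the identity, unrelated to the operation
    [Counit]. *)
Definition counit (A B : tm) : tm :=
  let f := App (shift 1 (forward A B)) (App (shift 1 (backward A B)) (var 0)) in
  lam (RightType A B)
    (funext f (var 0)
       (lam Tiny
          (funext (App (shift 1 f) (var 0)) (App (var 1) (var 0))
             (lam (App (shift 2 A) (var 0)) (counit_path A B))))).

(** Reads the annotations of a pair off its intended type [S]; returning [S] itself is a junk
    value. *)
Definition pair_at (S a b : tm) : tm :=
  match view_of S with VSig A B => pair A B a b | _ => S end.

(** [backward] serves as both inverses. The left homotopy is reflexivity, since that composite is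
    the identity by conversion. As [Prod] weakens its second factor, [unkeyed] recovers the factor
    from [R]. *)
Definition equivalence (A B : tm) : tm :=
  let X := LeftType A B in
  let Y := RightType A B in
  let f := forward A B in
  let g := backward A B in
  let S := BiInv X Y f in
  match view_of S with
  | VSig L R =>
      pair_at (Equiv X Y) f
        (pair_at S (pair_at L g (lam X (Refl (var 0))))
                   (pair_at (unkeyed 1 0 0 0 R) g (counit A B)))
  | _ => S
  end.

Definition ambient (i j : nat) : ctx := [Ty (Sqrt (U j)); Ty (Arrow Tiny (U i))].

Local Opaque fuel.

(** * Soundness of the checker *)

(** The checker sees only [D]; below it [G] is arbitrary, so that a single run is valid over every
    ambient context. *)
Definition typed (G D : ctx) (t A : tm) : Prop :=
  has_type (erase_ctx D ++ G) (erase t) (erase A).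

Definition equal (G D : ctx) (t u A : tm) : Prop :=
  eq_term (erase_ctx D ++ G) (erase t) (erase u) (erase A).

(** Identical erasures are accepted without a universe for the type, which reflexivity of [eq_term]
    would demand. *)
Definition convertible (G D : ctx) (A B : tm) : Prop :=
  erase A = erase B \/ exists l, eq_term (erase_ctx D ++ G) (erase A) (erase B) (U l).

Lemma typed_conv G D t A B : typed G D t A -> convertible G D A B -> typed G D t B.
Proof.
  unfold typed; intros H [<-|[l E]]; auto; eapply ty_conv; eauto.
Qed.

Lemma equal_conv G D t u A B : equal G D t u A -> convertible G D A B -> equal G D t u B.
Proof.
  unfold equal; intros H [<-|[l E]]; auto; eapply deq_conv; eauto.
Qed.

Lemma eq_term_cumul_le G A B i j :
  i <= j -> eq_term G A B (U i) -> eq_term G A B (U j).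
Proof. induction 1; auto using deq_cumul. Qed.

Lemma lookup_sound D x A l :
  lookup D x = Some (A, l) ->
  exists D1 D2, D = D1 ++ Ty A :: D2 /\ nvars D1 = x /\ nlocks D1 = l.
Proof.
  revert x l; induction D as [|[A'|] D IH]; simpl; intros x l H; [discriminate| |].
  - destruct x as [|x].
    + injection H as <- <-; exists [], D; auto.
    + destruct (IH _ _ H) as (D1 & D2 & -> & <- & <-).
      exists (Ty A' :: D1), D2; auto.
  - destruct (lookup D x) as [[A' l']|] eqn:E; [|discriminate]; injection H as -> <-.
    destruct (IH _ _ E) as (D1 & D2 & -> & <- & <-).
    exists (Lk :: D1), D2; auto.
Qed.

Lemma actf_erase n o m k t t' :
  actf n o m k t = Some t' -> act (erase_op o) m k (erase t) (erase t').
Proof. intros H; apply act_erase, (actf_sound _ _ _ _ _ _ H). Qed.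

Lemma Jtype_sound C b p T :
  Jtype C b p = Some T ->
  exists C1, act (Subst (erase b)) 1 0 (erase C) C1 /\
             act (Subst (erase p)) 0 0 C1 (erase T).
Proof.
  unfold Jtype; destruct (actf _ (Subst b) 1 0 C) as [C1|] eqn:E; [|discriminate].
  intros H; exists (erase C1); split; eapply (actf_erase fuel (Subst _)); eauto.
Qed.

Lemma level_sound T i : level T = Some i -> T = Some (U i).
Proof.
  unfold level; destruct T as [T|]; [|discriminate].
  destruct (view_of T) eqn:E; try discriminate.
  apply view_of_eq in E; intros [= ->]; subst; auto.
Qed.

Lemma eq_erased_eq t u : eq_erased t u = true -> erase t = erase u.
Proof. apply tm_eqb_eq. Qed.

Lemma wf_ext G D A l :
  typed G D A (U l) -> wf (erase_ctx (Ty A :: D) ++ G).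
Proof. intros H; exact (wf_ty _ _ _ H). Qed.

Lemma erase_app D1 D2 : erase_ctx (D1 ++ D2) = erase_ctx D1 ++ erase_ctx D2.
Proof. apply map_app. Qed.

(** The five functions at fuel [S n] call one another at fuel [n], so their soundness is one joint
    induction. *)
Record sound (G : ctx) (n : nat) : Prop := {
  infer_sound D t A :
    wf (erase_ctx D ++ G) -> infer n D t = Some A -> typed G D t A;
  check_sound D t A :
    wf (erase_ctx D ++ G) -> check n D t A = true -> typed G D t A;
  conv_sound D A B :
    wf (erase_ctx D ++ G) -> conv n D A B = true -> convertible G D A B;
  norm_sound D t t' A :
    wf (erase_ctx D ++ G) -> norm n D t = Some (t', A) ->
    typed G D t A /\ equal G D t t' A;
  norm_at_sound D t t' A :
    wf (erase_ctx D ++ G) -> norm_at n D t A = Some t' ->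
    typed G D t A /\ equal G D t t' A
}.

(** Inverts one step of a successful optional computation: a bind, a test, a pair or a view. *)
Ltac bind H :=
  match type of H with
  | match ?e with Some _ => _ | None => None end = Some _ =>
      let E := fresh "E" in destruct e eqn:E; [|discriminate H]
  | (if ?b then _ else None) = Some _ =>
      let E := fresh "E" in destruct b eqn:E; [|discriminate H];
      try (apply andb_true_iff in E; destruct E)
  | (let (_, _) := ?p in _) = Some _ => destruct p
  | match view_of ?t with _ => _ end = Some _ =>
      let E := fresh "E" in destruct (view_of t) eqn:E; try discriminate H;
      apply view_of_eq in E; simpl in E; subst
  end.

Lemma universe_sound G n D A l :
  sound G n -> wf (erase_ctx D ++ G) -> level (infer n D A) = Some l ->
  typed G D A (U l).
Proof. intros IH W H; apply level_sound in H; eapply infer_sound; eauto. Qed.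

Lemma typed_Jctx G n D A a l l' :
  sound G n -> wf (erase_ctx D ++ G) ->
  level (infer n D A) = Some l ->
  level (infer n (Ty A :: D) (Id (shift 1 A) (shift 1 a) (var 0))) = Some l' ->
  wf (erase_ctx (Jctx A a D) ++ G).
Proof.
  intros IH W HA HI; assert (WA := wf_ext _ _ _ _ (universe_sound _ _ _ _ _ IH W HA)).
  exact (wf_ext _ _ _ _ (universe_sound _ _ _ _ _ IH WA HI)).
Qed.

Lemma erase_Jctx G D A a :
  erase_ctx (Jctx A a D) ++ G =
  Ty (Id (shift 1 (erase A)) (shift 1 (erase a)) (var 0)) :: Ty (erase A) ::
    erase_ctx D ++ G.
Proof. simpl; unfold shift; rewrite !erase_keyed; auto. Qed.

Lemma erase_pointwise A B f g :
  erase (pointwise A B f g) = pointwise (erase A) (erase B) (erase f) (erase g).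
Proof. simpl; unfold shift; rewrite !erase_keyed; auto. Qed.

Lemma infer_step G n D t A :
  sound G n -> wf (erase_ctx D ++ G) -> infer (S n) D t = Some A -> typed G D t A.
Proof.
  intros IH W H; cbn [infer] in H.
  destruct (view_of t) eqn:Ev; try discriminate H; apply view_of_eq in Ev; simpl in Ev;
    subst t; repeat bind H; try (injection H as <-).
  - apply Nat.eqb_eq in H0; rewrite forallb_forall in H1.
    destruct (lookup_sound _ _ _ _ E) as (D1 & D2 & -> & <- & <-).
    assert (H1' : forall u, In u (map erase ts) ->
              has_type (erase_ctx (D1 ++ Ty t :: D2) ++ G) u Tiny).
    { intros u; rewrite in_map_iff; intros (v & <- & Hv).
      apply (check_sound _ _ IH _ _ Tiny); auto. }
    unfold typed; rewrite erase_app, <- app_assoc in *; simpl in *.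
    rewrite <- nvars_erase; apply ty_var with (A := erase t); auto.
    + rewrite length_map, nlocks_erase; auto.
    + rewrite nvars_erase; exact (actf_erase _ (Counit _ _) _ _ _ _ H).
  - apply ty_Tiny; auto.
  - apply ty_U; auto.
  - assert (HA := universe_sound _ _ _ _ _ IH W E).
    apply ty_Pi; auto.
    apply (universe_sound _ _ _ _ _ IH (wf_ext _ _ _ _ HA) E0).
  - assert (HA := universe_sound _ _ _ _ _ IH W E).
    apply ty_Lam; apply (infer_sound _ _ IH (Ty A0 :: D)); auto.
    eapply wf_ext; eauto.
  - apply infer_sound with (1 := IH) in E; auto.
    eapply ty_App; [exact E|apply (check_sound _ _ IH); eauto|].
    exact (actf_erase _ (Subst _) _ _ _ _ H).
  - assert (HA := universe_sound _ _ _ _ _ IH W E).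
    apply ty_Sig; auto.
    apply (universe_sound _ _ _ _ _ IH (wf_ext _ _ _ _ HA) E0).
  - assert (HA := universe_sound _ _ _ _ _ IH W E).
    assert (HB := universe_sound _ _ _ _ _ IH (wf_ext _ _ _ _ HA) E0).
    eapply ty_Pair; [exact HB|apply (check_sound _ _ IH); eauto| |].
    + exact (actf_erase _ (Subst _) _ _ _ _ E1).
    + apply (check_sound _ _ IH); auto.
  - apply ty_Id; [exact (universe_sound _ _ _ _ _ IH W E)| |];
      apply (check_sound _ _ IH); auto.
  - apply ty_Refl; apply (infer_sound _ _ IH); auto.
  - assert (WJ := typed_Jctx _ _ _ _ _ _ _ IH W E0 E1).
    assert (HC := universe_sound _ _ _ _ _ IH WJ E2).
    unfold typed in HC; rewrite erase_Jctx in HC.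
    destruct (Jtype_sound _ _ _ _ E3) as (C1 & ? & ?).
    destruct (Jtype_sound _ _ _ _ E4) as (C2 & ? & ?).
    apply ty_J with (A := erase A0) (a := erase a) (b := erase b) (Ca := erase t)
      (C1 := C1) (C2 := C2) (l := n2); auto; try (apply (check_sound _ _ IH); auto; fail).
    exact (infer_sound _ _ IH _ _ _ W E).
  - apply check_sound with (1 := IH) in H0, H1; auto.
    unfold typed in H1; rewrite erase_pointwise in H1.
    apply ty_Funext; auto; exact (infer_sound _ _ IH _ _ _ W E).
  - apply ty_Sqrt; exact (universe_sound _ _ (Lk :: D) _ _ IH (wf_lock _ W) E).
  - apply ty_Lock; exact (infer_sound _ _ IH (Lk :: D) _ _ (wf_lock _ W) E).
  - assert (WT : wf (erase_ctx (Ty Tiny :: D) ++ G)).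
    { apply wf_ext with 0; apply ty_Tiny; auto. }
    apply infer_sound with (1 := IH) in E; auto.
    eapply ty_Ev; [exact E|exact (actf_erase _ Unit _ _ _ _ H)].
Qed.

Lemma check_step G n D t A :
  sound G n -> wf (erase_ctx D ++ G) -> check (S n) D t A = true -> typed G D t A.
Proof.
  intros IH W H; cbn [check] in H; destruct (infer n D t) eqn:E; [|discriminate].
  eapply typed_conv; [eapply infer_sound|eapply conv_sound]; eauto.
Qed.

Lemma conv_step G n D A B :
  sound G n -> wf (erase_ctx D ++ G) -> conv (S n) D A B = true -> convertible G D A B.
Proof.
  intros IH W H; cbn [conv] in H; destruct (eq_erased A B) eqn:E.
  { left; apply eq_erased_eq; auto. }
  destruct (norm n D A) as [[A' K]|] eqn:EA; [|discriminate].
  destruct (norm n D B) as [[B' L]|] eqn:EB; [|discriminate].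
  destruct (level (Some K)) as [k|] eqn:EK; [|discriminate].
  destruct (level (Some L)) as [l|] eqn:EL; [|discriminate].
  apply level_sound in EK, EL; injection EK as ->; injection EL as ->.
  apply eq_erased_eq in H.
  destruct (norm_sound _ _ IH _ _ _ _ W EA) as [_ HA].
  destruct (norm_sound _ _ IH _ _ _ _ W EB) as [_ HB].
  (* The two types may have been found in different universes; cumulativity raises both equations to
     the maximum. *)
  right; exists (Nat.max k l); apply deq_trans with (erase A').
  - apply eq_term_cumul_le with k; [lia|exact HA].
  - rewrite H; apply deq_sym, eq_term_cumul_le with l; [lia|exact HB].
Qed.

Lemma norm_at_step G n D t t' A :
  sound G n -> wf (erase_ctx D ++ G) -> norm_at (S n) D t A = Some t' ->
  typed G D t A /\ equal G D t t' A.
Proof.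
  intros IH W H; cbn [norm_at] in H; repeat bind H; injection H as <-.
  destruct (norm_sound _ _ IH _ _ _ _ W E); apply conv_sound with (1 := IH) in E0; auto.
  split; [eapply typed_conv|eapply equal_conv]; eauto.
Qed.

Lemma norm_universe_sound G n D A A' K l :
  sound G n -> wf (erase_ctx D ++ G) -> norm n D A = Some (A', K) ->
  level (Some K) = Some l -> typed G D A (U l) /\ equal G D A A' (U l).
Proof.
  intros IH W H HK; apply level_sound in HK; injection HK as ->.
  eapply norm_sound; eauto.
Qed.

Lemma norm_step G n D t t' A :
  sound G n -> wf (erase_ctx D ++ G) -> norm (S n) D t = Some (t', A) ->
  typed G D t A /\ equal G D t t' A.
Proof.
  intros IH W H.
  (* Terms whose former has no clause in [norm] are returned unchanged with their inferred type. *)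
  assert (Default : infer n D t = Some A -> t' = t -> typed G D t A /\ equal G D t t' A).
  { intros E ->; apply infer_sound with (1 := IH) in E; auto.
    split; [|apply deq_refl]; auto. }
  cbn [norm] in H.
  destruct (view_of t) eqn:Ev; try discriminate H; apply view_of_eq in Ev; simpl in Ev;
    subst t; try (bind H; injection H as <- <-; auto; fail).
  all: clear Default.
  - repeat bind H; injection H as <- <-.
    destruct (norm_universe_sound _ _ _ _ _ _ _ IH W E E0) as [HA EA].
    destruct (norm_universe_sound _ _ _ _ _ _ _ IH (wf_ext _ _ _ _ HA) E1 E2) as [HB EB].
    split; [apply ty_Pi|apply deq_Pi]; auto.
  - bind H; bind H; bind H.
    assert (HA := universe_sound _ _ _ _ _ IH W E).
    destruct (norm_sound _ _ IH _ _ _ _ (wf_ext _ _ _ _ HA) E0) as [Hb Eb].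
    assert (Goal1 : typed G D (lam A0 b) (Pi A0 t0)) by (apply ty_Lam; auto).
    assert (Goal2 : equal G D (lam A0 b) (lam A0 t) (Pi A0 t0)) by (apply deq_Lam; auto).
    destruct (view_of t) eqn:Et; try (injection H as <- <-; auto; fail).
    apply view_of_eq in Et; simpl in Et; subst t.
    destruct (eq_erased _ _ && _) eqn:Ex; [|injection H as <- <-; auto].
    destruct (infer n D (unkeyed _ _ _ _ _)) as [F|] eqn:EF; [|discriminate].
    destruct (eq_erased F _) eqn:EFT; injection H as <- <-; auto.
    split; auto.
    (* η-contraction: the body is a weakened function applied to the bound variable, and that
       function has exactly the product type required. *)
    apply andb_true_iff in Ex; destruct Ex as [Ef Ea].
    apply eq_erased_eq in Ef, Ea, EFT; unfold shift in Ef; rewrite erase_keyed in Ef.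
    apply infer_sound with (1 := IH) in EF; auto; unfold typed in EF; rewrite EFT in EF.
    eapply deq_trans; [exact Goal2|].
    change (erase (lam A0 (App f a))) with (Lam (App (erase f) (erase a))).
    rewrite Ef, Ea; apply deq_sym, (deq_Pi_eta _ _ _ _ EF).
  - bind H; bind H; bind H; bind H; bind H.
    destruct (norm_sound _ _ IH _ _ _ _ W E) as [Hf Ef].
    destruct (norm_at_sound _ _ IH _ _ _ _ W E0) as [Ha Ea].
    apply actf_erase in E1.
    assert (Goal1 : typed G D (App f a) t1) by exact (ty_App _ _ _ _ _ _ Hf Ha E1).
    assert (Goal2 : equal G D (App f a) (App t t0) t1)
      by exact (deq_App _ _ _ _ _ _ _ _ Ef Ea E1).
    destruct (view_of t) eqn:Et; try (injection H as <- <-; auto; fail).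
    apply view_of_eq in Et; simpl in Et; subst t.
    repeat bind H; injection H as <- <-; split; auto.
    (* The annotation of the λ may differ from the domain found for the function, so β is applied at
       the annotated type and its result converted. *)
    assert (HA1 := universe_sound _ _ _ _ _ IH W E2).
    apply (infer_sound _ _ IH _ _ _ (wf_ext _ _ _ _ HA1)) in E3.
    apply actf_erase in E4, E5.
    apply check_sound with (1 := IH) in H0; auto.
    apply conv_sound with (1 := IH) in H1; auto.
    match goal with X : norm_at n D _ t1 = Some _ |- _ =>
      apply norm_at_sound with (1 := IH) in X; auto; destruct X as [_ Eu] end.
    eapply deq_trans; [exact Goal2|]; eapply deq_trans; [|exact Eu].
    eapply equal_conv with (2 := H1).
    exact (deq_Pi_beta _ _ _ _ _ _ _ E3 H0 E4 E5).
  - repeat bind H; injection H as <- <-.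
    destruct (norm_universe_sound _ _ _ _ _ _ _ IH W E E0) as [HA EA].
    destruct (norm_at_sound _ _ IH _ _ _ _ W E1) as [Ha Ea].
    destruct (norm_at_sound _ _ IH _ _ _ _ W E2) as [Hb Eb].
    split; [apply ty_Id|apply deq_Id]; auto.
  - repeat bind H; injection H as <- <-.
    destruct (norm_sound _ _ IH _ _ _ _ W E) as [Ha Ea].
    split; [apply ty_Refl|apply deq_Refl]; auto.
  - bind H; bind H; bind H; bind H; bind H; bind H; bind H; bind H; bind H; bind H.
    bind H; bind H.
    destruct (norm_sound _ _ IH _ _ _ _ W E) as [Hp Ep].
    assert (WJ := typed_Jctx _ _ _ _ _ _ _ IH W E0 E1).
    destruct (norm_universe_sound _ _ _ _ _ _ _ IH WJ E2 E3) as [HC EC].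
    unfold typed in HC; unfold equal in EC; rewrite erase_Jctx in HC, EC.
    destruct (norm_at_sound _ _ IH _ _ _ _ W E6) as [Hd Ed].
    apply check_sound with (1 := IH) in H0, H1; auto.
    destruct (Jtype_sound _ _ _ _ E4) as (C1 & S1 & S1').
    destruct (Jtype_sound _ _ _ _ E5) as (C2 & S2 & S2').
    assert (Goal1 : typed G D (J C d p) t3)
      by exact (ty_J _ _ _ _ _ _ _ _ _ _ _ _ HC S1 S1' Hd H1 Hp S2 S2').
    assert (Goal2 : equal G D (J C d p) (J t0 t4 t) t3)
      by exact (deq_J _ _ _ _ _ _ _ _ _ _ _ _ _ _ _ EC S1 S1' Ed H1 Ep S2 S2').
    destruct (view_of t) eqn:Et; try (injection H as <- <-; auto; fail).
    apply view_of_eq in Et; simpl in Et; subst t.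
    destruct (eq_erased _ _ && _) eqn:Ex; [|discriminate]; injection H as <- <-.
    apply andb_true_iff in Ex; destruct Ex as [Ea Ec].
    apply eq_erased_eq in Ea; apply conv_sound with (1 := IH) in Ec; auto.
    (* The normalised path is first replaced by reflexivity at [a], which has the same erasure; then
       β for J applies, at [Ca], which is convertible to [Cb]. *)
    split; auto; apply deq_trans with (J (erase C) (erase d) (Refl (erase a))).
    + rewrite Ea.
      exact (deq_J _ _ _ _ _ _ _ _ _ _ _ _ _ _ _ (deq_refl _ _ _ HC) S1 S1'
               (deq_refl _ _ _ Hd) H1 Ep S2 S2').
    + eapply equal_conv with (2 := Ec) (t := J C d (Refl a)).
      eapply deq_trans; [|exact Ed].
      exact (deq_J_beta _ _ _ _ _ _ _ _ H0 HC S1 S1' Hd).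
  - repeat bind H; injection H as <- <-.
    destruct (norm_universe_sound _ _ (Lk :: D) _ _ _ _ IH (wf_lock _ W) E E0) as [HA EA].
    split; [apply ty_Sqrt|apply deq_Sqrt]; auto.
  - bind H; bind H.
    destruct (norm_sound _ _ IH (Lk :: D) _ _ _ (wf_lock _ W) E) as [Ha Ea].
    assert (Goal1 : typed G D (Lock a) (Sqrt t0)) by exact (ty_Lock _ _ _ Ha).
    assert (Goal2 : equal G D (Lock a) (Lock t) (Sqrt t0)) by exact (deq_Lock _ _ _ _ Ea).
    destruct (view_of t) eqn:Et; try (injection H as <- <-; auto; fail).
    apply view_of_eq in Et; simpl in Et; subst t.
    destruct (eq_erased _ _) eqn:Er; [|injection H as <- <-; auto].
    destruct (infer n D (unkeyed _ _ _ _ _)) as [R|] eqn:ER; [|discriminate].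
    destruct (eq_erased R _) eqn:ERT; injection H as <- <-; auto.
    split; auto.
    apply eq_erased_eq in Er, ERT; unfold key in Er; rewrite erase_keyed in Er.
    apply infer_sound with (1 := IH) in ER; auto; unfold typed in ER; rewrite ERT in ER.
    eapply deq_trans; [exact Goal2|].
    change (erase (Lock (Ev r))) with (Lock (Ev (erase r))).
    rewrite Er; apply deq_sym, (deq_Sqrt_eta _ _ _ ER).
  - bind H; bind H; bind H; bind H.
    assert (WT : wf (erase_ctx (Ty Tiny :: D) ++ G)).
    { apply wf_ext with 0; apply ty_Tiny; auto. }
    destruct (norm_sound _ _ IH _ _ _ _ WT E) as [Hr Er].
    apply actf_erase in E0.
    assert (Goal1 : typed G D (Ev r) t0) by exact (ty_Ev _ _ _ _ Hr E0).
    assert (Goal2 : equal G D (Ev r) (Ev t) t0) by exact (deq_Ev _ _ _ _ _ Er E0).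
    destruct (view_of t) eqn:Et; try (injection H as <- <-; auto; fail).
    apply view_of_eq in Et; simpl in Et; subst t.
    repeat bind H; injection H as <- <-; split; auto.
    apply (infer_sound _ _ IH (Lk :: Ty Tiny :: D) _ _ (wf_lock _ WT)) in E1.
    apply actf_erase in E2, E3.
    apply conv_sound with (1 := IH) in E4; auto.
    destruct (norm_at_sound _ _ IH _ _ _ _ W E5) as [_ Eu].
    eapply deq_trans; [exact Goal2|]; eapply deq_trans; [|exact Eu].
    eapply equal_conv with (2 := E4).
    exact (deq_Sqrt_beta _ _ _ _ _ E1 E2 E3).
Qed.

Theorem checker_sound G n : sound G n.
Proof.
  induction n as [|n IH]; [split; discriminate|].
  split; intros; eauto using infer_step, check_step, conv_step, norm_step, norm_at_step.
Qed.

(** * Scoping *)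

(* A context shape lists its locks ([true]) and its variables ([false]). *)
Definition shape (G : ctx) : list bool :=
  map (fun e => match e with Ty _ => false | Lk => true end) G.

Definition vars (s : list bool) : nat := count_occ bool_dec s false.
Definition locks (s : list bool) : nat := count_occ bool_dec s true.
Definition binders (vl : nat * nat) : list bool :=
  repeat false (fst vl) ++ repeat true (snd vl).

Fixpoint locks_after (s : list bool) (x : nat) : option nat :=
  match s with
  | [] => None
  | true :: s => option_map S (locks_after s x)
  | false :: s => match x with 0 => Some 0 | S x => locks_after s x end
  end.

(** The part of typing that forgets types: each variable carries one key per lock to its right. This
    suffices for the counit at variable keys to be defined. *)
Inductive scoped : list bool -> tm -> Prop :=
  | scoped_var s x ts :
      locks_after s x = Some (length ts) -> Forall (scoped s) ts -> scoped s (Var x ts)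
  | scoped_op s f args :
      Forall (fun a => scoped (binders (fst a) ++ s) (snd a)) args ->
      scoped s (Op f args).

Lemma vars_app d s : vars (d ++ s) = vars d + vars s.
Proof. apply count_occ_app. Qed.

Lemma locks_app d s : locks (d ++ s) = locks d + locks s.
Proof. apply count_occ_app. Qed.

Lemma vars_binders v l : vars (binders (v, l)) = v.
Proof.
  unfold binders; rewrite vars_app; unfold vars; simpl.
  induction v; simpl; [induction l|]; simpl; auto.
Qed.

Lemma locks_binders v l : locks (binders (v, l)) = l.
Proof.
  unfold binders; rewrite locks_app; unfold locks; simpl.
  induction v; simpl; [induction l|]; simpl; auto.
Qed.

Lemma vars_shape G : vars (shape G) = nvars G.
Proof. induction G as [|[A|] G IH]; simpl; auto. unfold vars in *; simpl; auto. Qed.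

Lemma locks_shape G : locks (shape G) = nlocks G.
Proof. induction G as [|[A|] G IH]; simpl; auto. unfold locks in *; simpl; auto. Qed.

Lemma shape_app D G : shape (D ++ G) = shape D ++ shape G.
Proof. apply map_app. Qed.

Lemma locks_after_bound d s x :
  x < vars d -> locks_after (d ++ s) x = locks_after d x.
Proof.
  revert x; induction d as [|[] d IH]; unfold vars in *; simpl; intros x H; try lia.
  - rewrite IH; auto.
  - destruct x; auto; apply IH; lia.
Qed.

Lemma locks_after_free d s x :
  vars d <= x ->
  locks_after (d ++ s) x = option_map (Nat.add (locks d)) (locks_after s (x - vars d)).
Proof.
  revert x; induction d as [|[] d IH]; unfold vars, locks in *; simpl; intros x H.
  - rewrite Nat.sub_0_r; destruct (locks_after s x); auto.
  - rewrite IH; auto; destruct (locks_after s _); auto.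
  - destruct x; [lia|]; apply IH; lia.
Qed.

(** The change of context shape at the place of action; the part [d] to its right keeps its
    shape. *)
Inductive op_shapes : operation -> list bool -> list bool -> Prop :=
  | shapes_counit e s us :
      length us = locks e -> Forall (scoped (e ++ s)) us ->
      op_shapes (Counit (vars e) us) s (e ++ s)
  | shapes_subst s a : scoped s a -> op_shapes (Subst a) (false :: s) s
  | shapes_unit s : op_shapes Unit (true :: false :: s) s.

Lemma act_list_length o m k ts ts' : act_list o m k ts ts' -> length ts' = length ts.
Proof. induction 1; simpl; auto. Qed.

Lemma act_scoped_combined :
  (forall o m k t t', act o m k t t' -> forall d s s',
     op_shapes o s s' -> vars d = m -> locks d = k ->
     scoped (d ++ s) t -> scoped (d ++ s') t') /\
  (forall o m k ts ts', act_list o m k ts ts' -> forall d s s',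
     op_shapes o s s' -> vars d = m -> locks d = k ->
     Forall (scoped (d ++ s)) ts -> Forall (scoped (d ++ s')) ts') /\
  (forall o m k args args', act_args o m k args args' -> forall d s s',
     op_shapes o s s' -> vars d = m -> locks d = k ->
     Forall (fun a => scoped (binders (fst a) ++ d ++ s) (snd a)) args ->
     Forall (fun a => scoped (binders (fst a) ++ d ++ s') (snd a)) args').
Proof.
  apply act_combined.
  - intros o m k f args args' _ IH d s s' Ho Hm Hk H; inversion H; subst.
    constructor; eauto.
  - intros o m k n ks ks' Hn Hks IH d s s' Ho Hm Hk H; inversion H; subst.
    constructor; eauto.
    rewrite locks_after_bound in *; auto.
    rewrite (act_list_length _ _ _ _ _ Hks); auto.
  - intros w us m k n js ks js' ks' us' Hn Hk Hjs IHjs Hks IHks Hus IHus d s s' Ho Hm <- H.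
    inversion H as [? ? ? HL HF|]; subst; apply Forall_app in HF; destruct HF.
    inversion Ho as [e ? ? HLe HFe| |]; subst.
    assert (Fjs := IHjs _ _ _ Ho eq_refl eq_refl ltac:(eassumption)).
    assert (Fks := IHks _ _ _ Ho eq_refl eq_refl ltac:(eassumption)).
    apply act_list_length in Hjs, Hks, Hus.
    constructor.
    + rewrite app_assoc, locks_after_free by (rewrite vars_app; lia).
      rewrite locks_after_free in HL by auto.
      rewrite vars_app, locks_app.
      replace (n + vars e - (vars d + vars e)) with (n - vars d) by lia.
      destruct (locks_after s (n - vars d)); [|discriminate].
      injection HL as HL; rewrite length_app in HL; simpl.
      rewrite !length_app; f_equal; lia.
    + rewrite !Forall_app; repeat split; auto.
      (* The inserted keys live over [e ++ s], and the nested counit inserts all of [d] to the right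
         of that. *)
      apply IHus with (d := []) (s := e ++ s); auto.
      apply shapes_counit; auto; congruence.
  - intros a m k n ts ts' Hn Hts IH d s s' Ho Hm Hk H; inversion H as [? ? ? HL HF|]; subst.
    inversion Ho; subst; constructor; eauto.
    rewrite (act_list_length _ _ _ _ _ Hts), <- HL, !locks_after_free by lia.
    replace (S n - vars d) with (S (n - vars d)) by lia; auto.
  - intros a m k ts ts' a' Hk Hts IHts Ha IHa d s s' Ho Hm Hd H.
    inversion H as [? ? ? HL HF|]; subst; inversion Ho; subst.
    apply IHa with (d := []) (s := s'); auto.
    apply shapes_counit; [|eauto].
    apply act_list_length in Hts; congruence.
  - intros m k n js t ks js' ks' Hn Hk Hjs IHjs Hks IHks d s s' Ho Hm Hd H.
    inversion H as [? ? ? HL HF|]; subst; inversion Ho; subst.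
    apply Forall_app in HF; destruct HF as [? HF]; inversion HF; subst.
    constructor; [|rewrite Forall_app; split; eauto].
    rewrite locks_after_free in HL |- * by lia.
    replace (S n - vars d) with (S (n - vars d)) in HL by lia; simpl in HL.
    rewrite length_app in *; simpl in HL.
    rewrite (act_list_length _ _ _ _ _ Hjs), (act_list_length _ _ _ _ _ Hks).
    destruct (locks_after s' _); [|discriminate]; injection HL as HL; simpl; f_equal; lia.
  - intros m k t ks t' Hk Ht IH d s s' Ho Hm Hd H; inversion H as [? ? ? HL HF|]; subst.
    inversion HF; subst; eauto.
  - constructor.
  - intros o m k t t' ts ts' Ht IHt Hts IHts d s s' Ho Hm Hk H; inversion H; subst.
    constructor; eauto.
  - constructor.
  - intros o m k v l a a' args args' Ha IHa Hargs IHargs d s s' Ho Hm Hk H.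
    inversion H; subst; simpl in *; constructor; eauto; simpl.
    rewrite app_assoc in *; eapply IHa; eauto.
    + rewrite vars_app, vars_binders; lia.
    + rewrite locks_app, locks_binders; lia.
Qed.

Lemma act_scoped o D D' s s' t t' :
  act o (nvars D) (nlocks D) t t' -> act_tele o D D' -> op_shapes o s s' ->
  scoped (shape D ++ s) t -> scoped (shape D' ++ s') t'.
Proof.
  intros Ht HD Ho H.
  assert (E : shape D' = shape D) by (clear - HD; induction HD; simpl; f_equal; auto).
  rewrite E; eapply act_scoped_combined; [eauto..| | |]; eauto using vars_shape, locks_shape.
Qed.

(** * Typed terms are well scoped *)

(** [wf] stores only the typing of the latest type entry; storing it for all suffixes lets
    well-formedness pass to a shorter context. *)
Inductive wf_suffixes : ctx -> Prop :=
  | wf_suffixes_nil : wf_suffixes []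
  | wf_suffixes_ty G A l : has_type G A (U l) -> wf_suffixes G -> wf_suffixes (Ty A :: G)
  | wf_suffixes_lock G : wf_suffixes G -> wf_suffixes (Lk :: G).

Lemma wf_suffixes_wf G : wf_suffixes G -> wf G.
Proof. induction 1; econstructor; eauto. Qed.

Lemma act_U o m k l : act o m k (U l) (U l).
Proof. repeat constructor. Qed.

(** The image of a telescope is retyped entry by entry; the last hypothesis is the counit,
    substitution or unit rule itself, used at a universe. *)
Lemma wf_suffixes_tele o D D' G G' :
  act_tele o D D' -> wf_suffixes (D ++ G) -> wf_suffixes G' ->
  (forall D1 D1' A A' l, act_tele o D1 D1' -> has_type (D1 ++ G) A (U l) ->
     act o (nvars D1) (nlocks D1) A A' -> has_type (D1' ++ G') A' (U l)) ->
  wf_suffixes (D' ++ G').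
Proof.
  intros HD H H' HA; induction HD; simpl in *; auto; inversion H; subst.
  - eapply wf_suffixes_ty; eauto.
  - apply wf_suffixes_lock; auto.
Qed.

Lemma wf_suffixes_app D G : wf_suffixes (D ++ G) -> wf_suffixes G.
Proof. induction D; simpl; auto; inversion 1; auto. Qed.

Scheme wf_mut := Minimality for wf Sort Prop
  with has_type_mut := Minimality for has_type Sort Prop
  with eq_term_mut := Minimality for eq_term Sort Prop.
Combined Scheme typing_combined from wf_mut, has_type_mut, eq_term_mut.

(** Scoping is claimed of the term and not of its type, so conversion preserves it and equality
    judgements can carry [True]. The rules for counit, substitution and unit are covered by
    [act_scoped]. *)
Lemma typing_scoped :
  (forall G, wf G -> wf_suffixes G) /\
  (forall G a A, has_type G a A -> wf_suffixes G /\ scoped (shape G) a) /\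
  (forall G a b A, eq_term G a b A -> True).
Proof.
  apply typing_combined; intros; auto;
  repeat match goal with
  | H : wf_suffixes _ /\ _ |- _ => destruct H
  | H : wf_suffixes (Ty _ :: _) |- _ => inversion H; subst; clear H
  | H : wf_suffixes (Lk :: _) |- _ => inversion H; subst; clear H
  end;
  try (split; auto; repeat constructor; auto; fail).
  - constructor.
  - eapply wf_suffixes_ty; eauto.
  - apply wf_suffixes_lock; auto.
  - split; auto; rewrite shape_app; simpl; constructor.
    + rewrite locks_after_free by (rewrite vars_shape; auto).
      rewrite vars_shape, Nat.sub_diag, locks_shape; simpl; f_equal; lia.
    + apply Forall_forall; intros t Ht.
      change (scoped (shape D ++ shape (Ty A :: G)) t); rewrite <- shape_app.
      apply (H3 t Ht).
  - assert (Hs : op_shapes (Counit (nvars G') ts) (shape G) (shape G' ++ shape G)).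
    { rewrite <- vars_shape; apply shapes_counit; [rewrite locks_shape; auto|].
      apply Forall_forall; intros t Ht; rewrite <- shape_app; apply (H5 t Ht). }
    split.
    + eapply wf_suffixes_tele; eauto; intros; eapply ty_counit; eauto using act_U.
    + rewrite !shape_app in *; eapply act_scoped; eauto.
  - assert (Hs : op_shapes (Subst c) (false :: shape G) (shape G)) by (constructor; auto).
    split.
    + eapply wf_suffixes_tele; eauto; intros; eapply ty_subst; eauto using act_U.
    + rewrite !shape_app in *; eapply act_scoped; eauto.
  - split.
    + assert (HG : wf_suffixes G).
      { clear - H0; apply (wf_suffixes_app D) in H0; inversion H0 as [| |? HG].
        inversion HG; auto. }
      eapply wf_suffixes_tele; eauto; intros; eapply ty_unit; eauto using act_U.
    + rewrite !shape_app in *; eapply act_scoped; eauto using shapes_unit.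
Qed.

(** * The counit at variable keys is defined on scoped terms *)

Lemma act_list_map o m k f ts :
  Forall (fun t => act o m k t (f t)) ts -> act_list o m k ts (map f ts).
Proof. induction 1; simpl; constructor; auto. Qed.

Definition key_shapes (cs : list nat) (e : list bool) : Prop :=
  length cs = locks e /\ Forall (fun c => locks_after e c = Some 0) cs.

Lemma op_shapes_keyed cs e s :
  key_shapes cs e -> op_shapes (Counit (vars e) (map var cs)) s (e ++ s).
Proof.
  intros [HL HF]; constructor; [rewrite length_map; auto|].
  rewrite Forall_map; eapply Forall_impl; [|exact HF].
  intros c Hc; constructor; [|constructor].
  destruct (Nat.ltb_spec c (vars e)); [rewrite locks_after_bound; auto|].
  exfalso; rewrite <- (app_nil_r e), locks_after_free in Hc by auto; discriminate.
Qed.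

(* The second hypothesis is void for [cs = []], and that case then proves it. *)
Lemma act_keyed_if cs e :
  key_shapes cs e ->
  (forall c s t, In c cs -> scoped s t -> act (Counit 0 []) 0 0 t t) ->
  forall t d s, scoped (d ++ s) t ->
  act (Counit (vars e) (map var cs)) (vars d) (locks d) t
      (keyed (vars e) cs (vars d) (locks d) t).
Proof.
  intros He Hid t; induction t as [n ts IH|f args IH] using tm_forall_ind; intros d s H;
    inversion H as [? ? ? HL HF|? ? ? HF]; subst; cbn [keyed].
  - assert (Hts : act_list (Counit (vars e) (map var cs)) (vars d) (locks d) ts
                    (map (keyed (vars e) cs (vars d) (locks d)) ts)).
    { apply act_list_map; rewrite Forall_forall in *; eauto. }
    assert (HFs : Forall (scoped (d ++ e ++ s))
                    (map (keyed (vars e) cs (vars d) (locks d)) ts)).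
    { eapply act_scoped_combined; eauto using op_shapes_keyed. }
    destruct (Nat.ltb_spec n (vars d)) as [Hn|Hn]; [constructor; auto|].
    rewrite locks_after_free in HL by auto.
    assert (Hl : locks d <= length ts).
    { destruct (locks_after s _); [|discriminate]; injection HL; lia. }
    cbv zeta; rewrite length_map.
    set (p := length ts - locks d); set (ts' := map _ ts) in *.
    rewrite <- (firstn_skipn p ts) at 1.
    apply act_counit; auto.
    + rewrite length_skipn; lia.
    + apply act_list_firstn; auto.
    + apply act_list_skipn; auto.
    + assert (Hk : Forall (scoped (d ++ e ++ s)) (skipn p ts')).
      { rewrite <- (firstn_skipn p ts') in HFs; apply Forall_app in HFs; tauto. }
      (* A key that is itself a variable receives the keys [ks] only after these pass through a
         counit inserting nothing, which [Hid] shows to be the identity. *)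
      assert (Hcs : forall c, In c cs ->
                act_list (Counit 0 []) 0 0 (skipn p ts') (skipn p ts')).
      { intros c Hc; rewrite <- (map_id (skipn p ts')) at 2; apply act_list_map.
        eapply Forall_impl; [|exact Hk]; intros u Hu; apply (Hid c _ u Hc Hu). }
      clearbody ts'; clear - Hcs; induction cs as [|c cs IHcs]; simpl; constructor.
      * rewrite <- (app_nil_r (skipn p ts')) at 2.
        apply (act_counit _ _ 0 0 c [] [] [] [] (skipn p ts')); auto using act_list_nil.
        -- lia.
        -- apply (Hcs c); simpl; auto.
      * apply IHcs; intros c' Hc'; apply (Hcs c'); simpl; auto.
  - constructor; clear H.
    induction args as [|[[v l] a] args IHargs]; simpl; constructor; inversion IH; inversion HF;
      subst; simpl in *; auto.
    replace (vars d + v) with (vars (binders (v, l) ++ d))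
      by (rewrite vars_app, vars_binders; lia).
    replace (locks d + l) with (locks (binders (v, l) ++ d))
      by (rewrite locks_app, locks_binders; lia).
    eapply H1; rewrite <- app_assoc; eauto.
Qed.

(** [act_keyed_if] without keys yields some derivation, and [act_counit_nil] identifies its result
    as [t]. This in turn discharges the hypothesis of [act_keyed_if] for arbitrary keys. *)
Lemma act_counit_id s t : scoped s t -> act (Counit 0 []) 0 0 t t.
Proof.
  intros H; assert (He : key_shapes [] []) by (split; auto).
  assert (E := act_keyed_if [] [] He (fun _ _ _ Hc => match Hc with end) t [] s H).
  assert (E' := proj1 act_counit_nil _ _ _ _ _ E eq_refl).
  rewrite E' in E; exact E.
Qed.

Lemma act_keyed_exists cs e s t :
  key_shapes cs e -> scoped s t ->
  act (Counit (vars e) (map var cs)) 0 0 t (keyed (vars e) cs 0 0 t).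
Proof. intros He; apply act_keyed_if with (d := []); eauto using act_counit_id. Qed.

(** * Substitution into the type of equivalences *)

(** [act] sees only the numbers of variables and locks inserted, so one may take a telescope with
    all its locks to the left of its variables; every one of these is then a legal key. *)
Lemma act_keyed_scoped w cs s t :
  Forall (fun c => c < w) cs -> scoped s t ->
  act (Counit w (map var cs)) 0 0 t (keyed w cs 0 0 t).
Proof.
  intros Hcs Ht; assert (He : key_shapes cs (binders (w, length cs))).
  { split; [rewrite locks_binders; auto|].
    eapply Forall_impl; [|exact Hcs]; intros c Hc; unfold binders; simpl.
    clear - Hc; revert c Hc; induction w as [|w IH]; intros [|c] Hc; simpl; try lia; auto.
    apply IH; lia. }
  assert (H := act_keyed_exists _ _ _ _ He Ht); rewrite vars_binders in H; exact H.
Qed.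

Lemma keyed_shift w w' cs m k t :
  keyed w' cs m k (keyed w [] m k t) = keyed (w + w') cs m k t.
Proof.
  revert m k; induction t as [n ts IH|f args IH] using tm_forall_ind; intros m k; cbn [keyed].
  - assert (E : map (keyed w' cs m k) (map (keyed w [] m k) ts) =
                map (keyed (w + w') cs m k) ts).
    { rewrite map_map; apply map_ext_Forall; eapply Forall_impl; [|eauto]; auto. }
    destruct (Nat.ltb_spec n m) as [Hn|Hn]; cbn [keyed].
    + rewrite (proj2 (Nat.ltb_lt n m) Hn), E; auto.
    + rewrite (proj2 (Nat.ltb_ge (n + w) m)) by lia.
      cbv zeta; rewrite !app_nil_l, firstn_skipn, E, Nat.add_assoc; auto.
  - f_equal; rewrite map_map; apply map_ext_Forall; eapply Forall_impl; [|eauto].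
    intros [[v l] a] Ha; simpl in *; rewrite Ha; auto.
Qed.

Definition bump (m w c : nat) : nat := if c <? m then c else c + w.

(** The weakening takes place within the inserted telescope or at its left end, so it only enlarges
    the telescope and renumbers the keys. It has no keys of its own, hence the arbitrary [k']. *)
Lemma shift_keyed_at w w' cs m m' k k' t :
  m' <= w ->
  keyed w' [] (m + m') k' (keyed w cs m k t) = keyed (w + w') (map (bump m' w') cs) m k t.
Proof.
  intros Hm; revert m k k'; induction t as [n ts IH|f args IH] using tm_forall_ind;
    intros m k k'; cbn [keyed].
  - assert (E : map (keyed w' [] (m + m') k') (map (keyed w cs m k) ts) =
                map (keyed (w + w') (map (bump m' w') cs) m k) ts).
    { rewrite map_map; apply map_ext_Forall; eapply Forall_impl; [|eauto]; auto. }
    destruct (Nat.ltb_spec n m) as [Hn|Hn]; cbn [keyed].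
    + rewrite (proj2 (Nat.ltb_lt n (m + m'))) by lia; rewrite E; auto.
    + rewrite (proj2 (Nat.ltb_ge (n + w) (m + m'))) by lia.
      cbv zeta; rewrite !app_nil_l, firstn_skipn, !map_app, <- !firstn_map, <- !skipn_map.
      rewrite E, !length_map, Nat.add_assoc; do 3 f_equal.
      rewrite !map_map; apply map_ext; intros c; cbn [keyed]; unfold bump.
      rewrite <- !skipn_map, E.
      destruct (Nat.ltb_spec c m') as [Hc|Hc].
      * rewrite (proj2 (Nat.ltb_lt (c + m) (m + m'))) by lia; auto.
      * rewrite (proj2 (Nat.ltb_ge (c + m) (m + m'))) by lia.
        rewrite firstn_skipn; f_equal; lia.
  - f_equal; rewrite map_map; apply map_ext_Forall; eapply Forall_impl; [|eauto].
    intros [[v l] a] Ha; simpl in *.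
    replace (m + m' + v) with (m + v + m') by lia; rewrite Ha; auto.
Qed.

Lemma shift_keyed w w' cs m k t :
  m <= w ->
  keyed w' [] m k (keyed w cs 0 0 t) = keyed (w + w') (map (bump m w') cs) 0 0 t.
Proof. apply shift_keyed_at with (m := 0). Qed.

Definition unbump (m c : nat) : nat := if c <? m then c else pred c.

(** The replaced variable belongs to the inserted telescope and is not a key, so it does not occur
    and [b] is never inserted. *)
Lemma act_subst_keyed_at b w cs m m' k k' t :
  m' <= w -> ~ In m' cs ->
  act (Subst b) (m + m') k' (keyed (S w) cs m k t) (keyed w (map (unbump m') cs) m k t).
Proof.
  intros Hm Hcs; revert m k k'; induction t as [n ts IH|f args IH] using tm_forall_ind;
    intros m k k'; cbn [keyed].
  - assert (E : act_list (Subst b) (m + m') k' (map (keyed (S w) cs m k) ts)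
                  (map (keyed w (map (unbump m') cs) m k) ts)).
    { induction IH; simpl; constructor; auto. }
    destruct (Nat.ltb_spec n m) as [Hn|Hn]; [constructor; auto; lia|].
    cbv zeta; rewrite !length_map, <- plus_n_Sm; constructor; [lia|].
    set (us := map (keyed (S w) cs m k) ts) in *; set (us' := map (keyed w _ m k) ts) in *.
    clearbody us us'; set (p := length ts - k); clearbody p.
    assert (act_list_app : forall o m k ts ts' us us',
      act_list o m k ts ts' -> act_list o m k us us' ->
      act_list o m k (ts ++ us) (ts' ++ us'))
      by (induction 1; simpl; auto using act_list_cons).
    repeat apply act_list_app; auto using act_list_firstn, act_list_skipn.
    rewrite map_map; clear - E Hcs.
    induction cs as [|c cs IHcs]; simpl in *; constructor; auto.
    unfold unbump at 1; destruct (Nat.ltb_spec c m') as [Hc|Hc].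
    + constructor; [lia|]; apply act_list_skipn; auto.
    + destruct c as [|c]; [lia|]; simpl; constructor; [|apply act_list_skipn; auto].
      assert (S c <> m') by tauto; lia.
  - constructor; induction IH as [|[[v l] a] args Ha Hargs IHargs]; simpl; constructor; auto.
    replace (m + m' + v) with (m + v + m') by lia; apply Ha.
Qed.

Lemma act_subst_keyed b w cs m k t :
  m <= w -> ~ In m cs ->
  act (Subst b) m k (keyed (S w) cs 0 0 t) (keyed w (map (unbump m) cs) 0 0 t).
Proof. apply act_subst_keyed_at with (m := 0). Qed.

(** The keys are bound to the right of the replaced variable, so substitution fixes them and what
    remains is a counit at variable keys. *)
Lemma act_subst_leaf b w cs m k s :
  scoped s b -> length cs = k -> Forall (fun c => c < m) cs -> w = m ->
  act (Subst b) m k (Var m (map var cs)) (keyed w cs 0 0 b).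
Proof.
  intros Hb Hk Hcs ->; apply act_subst_same with (ts' := map var cs).
  - rewrite length_map; auto.
  - clear Hk; induction Hcs; simpl; repeat constructor; auto.
  - eapply act_keyed_scoped; eauto.
Qed.

Definition EquivType (A B : tm) : tm := Equiv (LeftType A B) (RightType A B).

(** Merges nested weakenings and keyings of a term into a single [keyed], so that [act_subst_tac]
    meets only formers, variables and such leaves. *)
Ltac expand_equiv :=
  unfold EquivType, LeftType, RightType, Equiv, BiInv, Prod, Transpension, Down, Arrow,
    shift, key, Sig, Pi, Sqrt, App, Id, Ev, Tiny, var; simpl;
  repeat match goal with
  | |- context [keyed ?w' ?cs ?m ?k (keyed ?w [] ?m ?k ?t)] =>
      rewrite (keyed_shift w w' cs m k t)
  | |- context [keyed ?w' [] ?m ?k (keyed ?w ?cs 0 0 ?t)] =>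
      rewrite (shift_keyed w w' cs m k t) by lia
  end; cbn.

Ltac act_subst_tac Hb :=
  repeat match goal with
  | |- act _ _ _ (Op _ _) _ => apply act_former
  | |- act_args _ _ _ (_ :: _) _ => apply act_args_cons
  | |- act_args _ _ _ [] _ => apply act_args_nil
  | |- act _ _ _ (Var _ _) (Var _ _) => apply act_bound; [lia|]
  | |- act_list _ _ _ (_ :: _) _ => apply act_list_cons
  | |- act_list _ _ _ [] _ => apply act_list_nil
  | |- act (Subst ?b) ?m ?k (keyed (S ?w) ?cs 0 0 ?t) _ =>
      refine (act_subst_keyed b w cs m k t _ _); [lia|simpl; lia]
  | |- act (Subst ?b) ?m ?k _ (keyed ?w ?cs 0 0 ?b) =>
      refine (act_subst_leaf b w cs m k _ Hb _ _ _); [reflexivity| |reflexivity];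
      repeat constructor
  end.

Lemma act_subst_EquivType_fst a s :
  scoped s a ->
  act (Subst a) 1 0 (EquivType (var 1) (var 0)) (EquivType (shift 1 a) (var 0)).
Proof. intros H; expand_equiv; act_subst_tac H. Qed.

Lemma act_subst_EquivType_snd a b s :
  scoped s b ->
  act (Subst b) 0 0 (EquivType (shift 1 a) (var 0)) (EquivType a b).
Proof. intros H; expand_equiv; act_subst_tac H. Qed.

(** * The equivalence for variables and its instances *)

Lemma wf_ambient i j G : wf G -> wf (erase_ctx (ambient i j) ++ G).
Proof.
  intros W; assert (W1 : wf (Ty (Arrow Tiny (U i)) :: G)).
  { assert (WT : wf (Ty Tiny :: G)) by (eapply wf_ty, ty_Tiny; auto).
    eapply wf_ty, ty_Pi; [apply ty_Tiny; auto|apply ty_U; auto]. }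
  eapply wf_ty, ty_Sqrt, ty_U, wf_lock; exact W1.
Qed.

Lemma equivalence_typed i j G :
  wf G ->
  has_type (Ty (Sqrt (U j)) :: Ty (Arrow Tiny (U i)) :: G)
    (erase (equivalence (var 1) (var 0))) (EquivType (var 1) (var 0)).
Proof.
  intros W.
  apply (check_sound G 100 (checker_sound G 100) (ambient i j)
           (equivalence (var 1) (var 0)) (EquivType (var 1) (var 0))).
  - apply wf_ambient; auto.
  (* The run of the checker on the whole equivalence; [G] does not enter it. *)
  - vm_compute; reflexivity.
Qed.

Theorem proposition4p4 :
  forall (i j : nat) (G : ctx) (A B : tm),
    has_type G A (Arrow Tiny (U i)) ->
    has_type G B (Sqrt (U j)) ->
    exists e : tm,
      has_type G e
        (Equiv
           (Sqrt (Arrow (Pi Tiny (App (key A) (var 0))) (Down B)))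
           (Pi Tiny
              (Arrow (App (shift 1 A) (var 0))
                     (Transpension (shift 1 B) (var 0))))).
Proof.
  intros i j G A B HA HB.
  destruct (proj1 (proj2 typing_scoped) _ _ _ HA) as [W SA].
  destruct (proj1 (proj2 typing_scoped) _ _ _ HB) as [_ SB].
  (* Abstracting and applying, instead of substituting into the large term, leaves substitutions in
     its type only. *)
  exists (App (App (Lam (Lam (erase (equivalence (var 1) (var 0))))) A) B).
  apply ty_App with (A := Sqrt (U j)) (B := EquivType (shift 1 A) (var 0)); auto.
  - apply ty_App with (A := Arrow Tiny (U i))
      (B := Pi (Sqrt (U j)) (EquivType (var 1) (var 0))); auto.
    + apply ty_Lam, ty_Lam, equivalence_typed, wf_suffixes_wf; auto.
    + apply act_former, act_args_cons; [repeat constructor|].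
      exact (act_args_cons _ 0 0 1 0 _ _ _ _ (act_subst_EquivType_fst _ _ SA)
               (act_args_nil _ _ _)).
  - eapply act_subst_EquivType_snd; eauto.
Qed.
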